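(* Let $\mathbb{B}$ be a finite structure with a finite relational signature $\tau$, and let $\mathrm{Q}_1\cdots\mathrm{Q}_n$ ($n\ge 1$, each $\mathrm{Q}_i\in\{\exists,\forall\}$) be a quantifier prefix containing at least one universal quantifier. Then there exists a countable $\omega$-categorical structure $\mathbb{D}$ with a finite relational signature such that: (i) $\mathrm{CSP}(\mathbb{D})$ is expressible in $\mathrm{Q}_1\cdots\mathrm{Q}_n$MSO, i.e., the class of finite structures that homomorphically map to $\mathbb{D}$ is exactly the class of finite models of a monadic second-order sentence whose second-order quantifier prefix consists of consecutive blocks of quantifiers of types $\mathrm{Q}_1,\dots,\mathrm{Q}_n$ (in this order); and (ii) $\mathrm{Q}_1\cdots\mathrm{Q}_n\mathrm{QCSP}(\mathbb{B})$ reduces in polynomial time to $\mathrm{CSP}(\mathbb{D})$.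
   Context: A countable structure is $\omega$-categorical if for every $k\ge1$ only finitely many $k$-ary relations are first-order definable (without parameters) in it. For a structure $\mathbb{D}$ with finite relational signature $\sigma$, $\mathrm{CSP}(\mathbb{D})$ is the decision problem (equivalently, the class) of finite $\sigma$-structures admitting a homomorphism to $\mathbb{D}$. A quantified primitive positive (qpp) $\tau$-sentence is a prenex sentence whose quantifier-free part is a conjunction of atomic formulas (of the form $\bot$, $x=y$, or $R(\bar x)$ with $R\in\tau$), where both $\exists$ and $\forall$ are allowed. $\mathrm{Q}_1\cdots\mathrm{Q}_n\mathrm{QCSP}(\mathbb{B})$ is the problem of deciding whether a given qpp $\tau$-sentence of the form $\mathrm{Q}_1\bar x_1\cdots\mathrm{Q}_n\bar x_n\,\phi$ (with $\bar x_i$ tuples of variables and $\phi$ a conjunction of atoms) holds in $\mathbb{B}$. MSO (monadic second-order logic) extends first-order logic with quantification over unary relation variables. *)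

(* Defs.v *)
From HB Require Import structures.
From mathcomp Require Import all_boot.
From mathcomp Require Import boolp classical_sets cardinality.

Set Implicit Arguments.
Unset Strict Implicit.
Unset Printing Implicit Defensive.

Local Open Scope classical_set_scope.

(** * Relational structures *)

Record signature := Signature { symb :> finType; arity : symb -> nat }.

Definition structure (tau : signature) (T : Type) :=
  forall R : tau, set ((arity R).-tuple T).

Definition homomorphism (tau : signature) (T U : Type)
    (A : structure tau T) (B : structure tau U) (h : T -> U) : Prop :=
  forall (R : tau) (t : (arity R).-tuple T), A R t -> B R (map_tuple h t).

Definition CSP (tau : signature) (T : Type) (D : structure tau T)
    (X : finType) (A : structure tau X) : Prop :=
  exists h : X -> T, homomorphism A D h.

(** * First-order formulas with free set variables

   Variables are well scoped: in [fo tau m n] the free first-order variables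
   are the elements of ['I_n] and the free set variables those of ['I_m].  A
   binder introduces the variable [ord_max : 'I_n.+1].  An assignment is a
   function on the variables in scope, so sentences are also meaningful in
   structures with empty domain. *)

Inductive atom (tau : signature) (n : nat) : Type :=
| AFalse
| AEq of 'I_n & 'I_n
| ARel (R : tau) of (arity R).-tuple 'I_n.

Inductive fo (tau : signature) (m n : nat) : Type :=
| FAtom of atom tau n
| FMem of 'I_m & 'I_n
| FNot of fo tau m n
| FAnd of fo tau m n & fo tau m n
| FOr of fo tau m n & fo tau m n
| FAll of fo tau m n.+1
| FEx of fo tau m n.+1.

Definition sat_atom (tau : signature) (T : Type) (A : structure tau T)
    (n : nat) (e : 'I_n -> T) (a : atom tau n) : Prop :=
  match a with
  | AFalse => False
  | AEq x y => e x = e y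
  | ARel R t => A R (map_tuple e t)
  end.

Definition extend (T : Type) (n : nat) (e : 'I_n -> T) (a : T) : 'I_n.+1 -> T :=
  fun i => if unlift ord_max i is Some j then e j else a.

Fixpoint sat_fo (tau : signature) (T : Type) (A : structure tau T)
    (m n : nat) (V : 'I_m -> set T) (e : 'I_n -> T) (phi : fo tau m n)
    {struct phi} : Prop :=
  match phi with
  | FAtom a => sat_atom A e a
  | FMem X x => V X (e x)
  | FNot p => ~ sat_fo A V e p
  | FAnd p q => sat_fo A V e p /\ sat_fo A V e q
  | FOr p q => sat_fo A V e p \/ sat_fo A V e q
  | FAll p => forall a, sat_fo A V (extend e a) p
  | FEx p => exists a, sat_fo A V (extend e a) p
  end.

Definition no_vars (T : Type) : 'I_0 -> T := fun i => False_rect T (notF (ltn_ord i)).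

Definition defined_relation (tau : signature) (T : Type) (A : structure tau T)
    (k : nat) (phi : fo tau 0 k) : set (k.-tuple T) :=
  [set t | sat_fo A (@no_vars _) (tnth t) phi].

Definition omega_categorical (tau : signature) (T : Type)
    (A : structure tau T) : Prop :=
  forall k : nat, 1 <= k -> finite_set (range (@defined_relation tau T A k)).

(** * Prefixes made of blocks of quantifiers

   [prenex F m Qs]: an element of [F], preceded by one (possibly empty) block
   of quantifiers for each entry of [Qs], with [m] free variables.  A block of
   [k] quantifiers over [m] earlier variables leaves [m + k] variables in
   scope, the bound ones being the [rshift m j]. *)

Inductive quant := QEx | QAll.

Inductive prenex (F : nat -> Type) (m : nat) : seq quant -> Type :=
| Matrix of F m : prenex F m [::]
| Block (q : quant) (Qs : seq quant) (k : nat) of prenex F (m + k) Qs :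
    prenex F m (q :: Qs).

Definition extend_block (T : Type) (m k : nat) (e : 'I_m -> T) (v : 'I_k -> T) :
    'I_(m + k) -> T :=
  fun i => match split i with inl j => e j | inr j => v j end.

Fixpoint sat_prenex (F : nat -> Type) (T : Type)
    (sat : forall m : nat, ('I_m -> T) -> F m -> Prop)
    (m : nat) (Qs : seq quant) (e : 'I_m -> T) (phi : prenex F m Qs)
    {struct phi} : Prop :=
  match phi with
  | Matrix p => sat m e p
  | Block QEx _ k p =>
      exists v : 'I_k -> T, sat_prenex sat (extend_block e v) p
  | Block QAll _ k p =>
      forall v : 'I_k -> T, sat_prenex sat (extend_block e v) p
  end.

(** Monadic second-order sentences: blocks of set quantifiers followed by a
    first-order formula without free first-order variables. *)
Definition mso_sentence (tau : signature) (Qs : seq quant) : Type :=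
  prenex (fun m => fo tau m 0) 0 Qs.

Definition mso_holds (tau : signature) (T : Type) (A : structure tau T)
    (Qs : seq quant) (phi : mso_sentence tau Qs) : Prop :=
  sat_prenex (fun m (V : 'I_m -> set T) => sat_fo A V (@no_vars T))
             (@no_vars (set T)) phi.

(** Quantified primitive positive sentences: blocks of first-order quantifiers
    followed by a conjunction of atomic formulas. *)
Definition qpp_sentence (tau : signature) (Qs : seq quant) : Type :=
  prenex (fun m => seq (atom tau m)) 0 Qs.

Definition QCSP (tau : signature) (T : Type) (B : structure tau T)
    (Qs : seq quant) (phi : qpp_sentence tau Qs) : Prop :=
  sat_prenex (fun m e (s : seq (atom tau m)) =>
                forall i : 'I_(size s), sat_atom B e (tnth (in_tuple s) i))
             (@no_vars T) phi.

(** * Encoding of instances as binary words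

   An instance is first written as a sequence of numbers, each of which is then
   written in unary.  A sentence lists its variables and a structure its
   elements, so the unary words are at most polynomially longer than binary
   ones. *)

Definition word := seq bool.

Definition unary (s : seq nat) : word :=
  flatten [seq rcons (nseq k true) false | k <- s].

Definition atom_code (tau : signature) (n : nat) (a : atom tau n) : seq nat :=
  match a with
  | AFalse => [:: 0]
  | AEq x y => [:: 1; val x; val y]
  | ARel R t => (enum_rank R).+2 :: map val t
  end.

Fixpoint qpp_code (tau : signature) (m : nat) (Qs : seq quant)
    (phi : prenex (fun m => seq (atom tau m)) m Qs) {struct phi} : seq nat :=
  match phi with
  | Matrix s => flatten (map (@atom_code tau m) s)
  | Block _ _ k p => k :: qpp_code p
  end.

Definition encodes_sentence (tau : signature) (Qs : seq quant)
    (phi : qpp_sentence tau Qs) (w : word) : Prop :=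
  w = unary (qpp_code phi).

(** A structure with domain ['I_N] is given by [N] followed by a list of the
    tuples in its relations, in any order. *)
Definition fact (tau : signature) (N : nat) :=
  {R : tau & (arity R).-tuple 'I_N}.

Definition fact_code (tau : signature) (N : nat) (f : fact tau N) : seq nat :=
  val (enum_rank (tag f)) :: map val (tagged f).

Definition finite_structure (tau : signature) : Type :=
  {N : nat & structure tau 'I_N}.

Definition encodes_structure (tau : signature) (A : finite_structure tau)
    (w : word) : Prop :=
  exists s : seq (fact tau (tag A)),
    (forall (R : tau) (t : (arity R).-tuple 'I_(tag A)),
       tagged A R t <->
       Tagged (fun R : tau => (arity R).-tuple 'I_(tag A)) t \in s) /\
    w = unary (tag A :: flatten (map (@fact_code tau (tag A)) s)).

(** * Polynomial-time reductions

   Deterministic Turing machines with [tapes.+1] two-way infinite tapes.  A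
   cell contains a bit, a work symbol, or is blank ([None]). *)

Inductive move := MLeft | MStay | MRight.

Record tm := TM {
  tapes : nat;
  work : finType;
  state : finType;
  start : state;
  final : pred state;
  delta : state -> (tapes.+1).-tuple (option (bool + work)) ->
          state * (tapes.+1).-tuple (option (bool + work) * move) }.

(** [before] is listed from the head leftwards; cells not listed are blank. *)
Record tape (C : Type) := Tape {
  before : seq (option C); under : option C; after : seq (option C) }.

Definition write_move (C : Type) (t : tape C) (a : option C * move) : tape C :=
  let: Tape l _ r := t in
  match a.2 with
  | MLeft => Tape (behead l) (head None l) (a.1 :: r)
  | MStay => Tape l a.1 r
  | MRight => Tape (a.1 :: l) (head None r) (behead r)
  end.

Definition config (M : tm) : Type :=
  (state M * (tapes M).+1.-tuple (tape (bool + work M)))%type.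

Definition step (M : tm) (c : config M) : config M :=
  if final c.1 then c else
  let: (q, acts) := delta c.1 (map_tuple (@under _) c.2) in
  (q, [tuple write_move (tnth c.2 i) (tnth acts i) | i < (tapes M).+1]).

(** The input is on tape [0], with the head on its first letter. *)
Definition input_tape (W : Type) (w : word) : tape (bool + W) :=
  let s := [seq Some (inl b) | b <- w] in
  Tape [::] (head None s) (behead s).

Definition init (M : tm) (w : word) : config M :=
  (start M, [tuple if i == ord0 then input_tape (work M) w
                   else Tape [::] None [::] | i < (tapes M).+1]).

Fixpoint leading_bits (W : Type) (s : seq (option (bool + W))) : word :=
  if s is Some (inl b) :: s' then b :: leading_bits s' else [::].

(** The output is the longest word of bits on tape [0] starting at the head. *)
Definition output (M : tm) (c : config M) : word :=
  let t := tnth c.2 ord0 in leading_bits (under t :: after t).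

Definition computes_within (M : tm) (w : word) (time : nat) (w' : word) : Prop :=
  let c := iter time (@step M) (init M w) in final c.1 /\ output c = w'.

(** The problem of deciding [P] on the instances [I] reduces in polynomial time
    to the problem of deciding [Q] on the instances [J].  Since [0 ^ c + c] and
    [1 ^ c + c] are at least [c], every polynomial is bounded by some
    [n ^ c + c]. *)
Definition poly_time_reduces
    (I : Type) (encI : I -> word -> Prop) (P : I -> Prop)
    (J : Type) (encJ : J -> word -> Prop) (Q : J -> Prop) : Prop :=
  exists (M : tm) (c : nat), forall (x : I) (w : word), encI x w ->
    exists (y : J) (w' : word),
      [/\ computes_within M w (size w ^ c + c) w', encJ y w' & P x <-> Q y].

Definition QCSP_reduces_to_CSP (tau : signature) (T : Type)
    (B : structure tau T) (Qs : seq quant)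
    (sigma : signature) (U : Type) (D : structure sigma U) : Prop :=
  poly_time_reduces (@encodes_sentence tau Qs) (@QCSP tau T B Qs)
    (@encodes_structure sigma) (fun A => CSP D (tagged A)).

(* Main.v *)
(** Instances of the template are structures whose elements play the role of
    variables: they carry the constraints of the sentence, a marker for the block
    of each variable, and a binary relation holding between distinct variables.
    On such a structure the players of a game label the elements with sets of
    values, one labelling per quantifier block.  The existential player must give
    every element some label; a labelling by the universal player is legal when
    differently labelled points are related by the distinctness relation, so on
    an actual instance no element gets two values.  The universal player wins if
    some constraint is violated.  Both this condition and legality are preserved by
    forward images, hence the class of structures won by the existential player
    is closed under inverse homomorphisms, and it is closed under disjoint unions
    as legality passes to subsets.  The game is literally an MSO sentence with the
    given prefix.

    The [omega]-categorical structure is built greedily on the natural numbers: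
    every finite structure glued freshly along a tuple is added whenever the
    result is still won.  The effect of gluing depends only on a game type taken
    from a finite set (Feferman-Vaught composition), so there are finitely many
    primitive positive types of [k]-tuples.  These types are maximal, which gives
    back-and-forth, hence finitely many definable relations.

    Since the constraint symbols are enumerated like the atoms in the encoding of
    sentences, the reduction keeps the code of the matrix verbatim, merges the
    block sizes, and appends the markers and the distinctness facts. *)

Require Import Defs.
From mathcomp Require Import all_boot.
From mathcomp Require Import boolp classical_sets cardinality.
From mathcomp Require Import zify.

Set Implicit Arguments.
Unset Strict Implicit.
Unset Printing Implicit Defensive.

(** * The labelling game *)

Section Game.

Variables (kappa : signature) (B : finType) (KB : structure kappa B) (n : nat).
Arguments KB : clear implicits.

Definition game_arity (s : kappa + option 'I_n) : nat :=
  match s with inl c => arity c | inr None => 2 | inr (Some _) => 1 end.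

Definition game_sig : signature := Signature game_arity.

Notation sigma := game_sig.

Definition constr (c : kappa) : sigma := inl c.
Definition distinct_sym : sigma := inr None.
Definition block_sym (i : 'I_n) : sigma := inr (Some i).

Section Moves.

Variables (T : Type) (S : structure sigma T).
Arguments S : clear implicits.

(** Labels are sets because a homomorphism may identify points with different labels; their image
    then carries the union. *)
Definition labelling : Type := T -> nat -> {set B}.

Definition unlabelled : labelling := fun _ _ => finset.set0.

Definition relabel (H : labelling) (i : nat) (w : T -> {set B}) : labelling :=
  fun x j => if j == i then w x else H x j.

Definition in_block (i : 'I_n) (x : T) : Prop := S (block_sym i) [tuple x].

(** Symmetrised, so that an instance may list each pair of distinct variables once. *)
Definition apart (x y : T) : Prop :=
  S distinct_sym [tuple x; y] \/ S distinct_sym [tuple y; x].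

Definition has_value (H : labelling) (x : T) (b : B) : Prop :=
  exists2 i : 'I_n, in_block i x & b \in H x i.

Definition violated (H : labelling) : Prop :=
  exists (c : kappa) (t : (arity c).-tuple T) (v : (arity c).-tuple B),
    [/\ S (constr c) t, ~ KB c v & forall j, has_value H (tnth t j) (tnth v j)].

(** The case [x = y] is included: a point may carry two values only if it is apart from itself,
    which no variable of an actual instance is. *)
Definition legal (w : T -> {set B}) : Prop :=
  forall x y b b', b \in w x -> b' \in w y -> b != b' -> apart x y.

Fixpoint wins (Qs : seq quant) (i : nat) (H : labelling) : Prop :=
  match Qs with
  | [::] => ~ violated H
  | QEx :: Qs' =>
      exists w : T -> {set B},
        (forall x, w x != finset.set0) /\ wins Qs' i.+1 (relabel H i w)
  | QAll :: Qs' =>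
      forall w : T -> {set B}, legal w -> wins Qs' i.+1 (relabel H i w)
  end.

End Moves.

Lemma has_value_hom (T U : Type) (S : structure sigma T) (S' : structure sigma U)
    (h : T -> U) (H : labelling T) (H' : labelling U) x b :
  homomorphism S S' h -> (forall x j, H x j \subset H' (h x) j) ->
  has_value S H x b -> has_value S' H' (h x) b.
Proof.
move=> hh HH [i Pi bH]; exists i => //; last exact: (fintype.subsetP (HH x i) _ bH).
have := hh _ _ Pi; rewrite /in_block.
by congr (S' _ _); apply: val_inj.
Qed.

Lemma apart_hom (T U : Type) (S : structure sigma T) (S' : structure sigma U)
    (h : T -> U) x y :
  homomorphism S S' h -> apart S x y -> apart S' (h x) (h y).
Proof.
move=> hh [] /hh E; [left|right]; move: E;
  by congr (S' _ _); apply: val_inj.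
Qed.

(* The universal player's moves are pushed forward along the homomorphism, the
   existential player's moves are pulled back. *)
Lemma wins_hom (T U : Type) (S : structure sigma T) (S' : structure sigma U)
    (h : T -> U) (hh : homomorphism S S' h) Qs :
  forall i (H : labelling T) (H' : labelling U),
  (forall x j, H x j \subset H' (h x) j) ->
  wins S' Qs i H' -> wins S Qs i H.
Proof.
elim: Qs => [|[] Qs IH] i H H' HH /=.
- move=> nv [c [t [v [St nK tv]]]]; apply: nv.
  exists c, (map_tuple h t), v; split=> //; first exact: (hh _ _ St).
  by move=> j; rewrite tnth_map; apply: has_value_hom (tv j).
- move=> [w [w0 ww]]; exists (fun x => w (h x)); split=> [x //|].
  by apply: IH ww => x j; rewrite /relabel; case: ifP.
- move=> ww w lw.
  (* The pushed-forward move takes unions of labels over fibres. Two different values in it come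
     from points that are apart, and homomorphisms preserve this. *)
  pose W y := finset (fun b => `[< exists2 x, h x = y & b \in w x >]).
  have lW : legal S' W.
    move=> x y b b'; rewrite !finset.inE => /asboolP[u <- bu] /asboolP[v <- bv] nb.
    exact: apart_hom (lw _ _ _ _ bu bv nb).
  apply: IH (ww _ lW) => x j; rewrite /relabel; case: ifP => // _.
  by apply/fintype.subsetP => b bw; rewrite finset.inE; apply/asboolP; exists x.
Qed.

(** The pushout of [S] and [A] over [k] named points, which [a] need not send to distinct points. *)
Definition glue (T X : Type) (k : nat) (S : structure sigma T) (a : 'I_k -> T)
    (A : structure sigma ('I_k + X)) : structure sigma (T + X) :=
  fun R t => (exists2 s, S R s & t = map_tuple inl s) \/
    (exists2 s, A R s & t = map_tuple
       (fun z => match z with inl j => inl (a j) | inr x => inr x end) s).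
Arguments glue [T X k] S a A R t.

Definition join (T X Y : Type) (f : T -> Y) (g : X -> Y) (z : T + X) : Y :=
  match z with inl x => f x | inr y => g y end.

Lemma glue_hom (T X U : Type) (k : nat) (S : structure sigma T) (a : 'I_k -> T)
    (A : structure sigma ('I_k + X)) (D : structure sigma U)
    (f : T -> U) (g : X -> U) :
  homomorphism S D f -> homomorphism A D (join (f \o a) g) ->
  homomorphism (glue S a A) D (join f g).
Proof.
move=> hf hg R t [[s Ss ->]|[s As ->]].
  have := hf _ _ Ss; congr (D _ _).
  by apply: eq_from_tnth => j; rewrite !tnth_map.
have := hg _ _ As; congr (D _ _).
by apply: eq_from_tnth => j; rewrite !tnth_map; case: (tnth s j).
Qed.

(* Without shared points the players play independently on both parts; this
   uses that restrictions of legal moves are legal. *)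
Lemma wins_disjoint (T X : Type) (S : structure sigma T) (a : 'I_0 -> T)
    (A : structure sigma ('I_0 + X)) Qs :
  forall i (H : labelling T) (HA : labelling ('I_0 + X)),
  wins S Qs i H -> wins A Qs i HA ->
  wins (glue S a A) Qs i (join H (HA \o inr)).
Proof.
have no0 (z : 'I_0) (P : Prop) : P by case: z.
pose g (z : 'I_0 + X) : T + X := match z with inl j => inl (a j) | inr x => inr x end.
(* A nullary fact of the glued structure may come from either side, so facts are traced back only
   for positive arity; violated constraints are split below by the side their fact comes from. *)
have facts_l R (s : (arity R).-tuple T) : 0 < arity R ->
    glue S a A R (map_tuple inl s) -> S R s.
  move=> R0 [[s' Ss]|[s' As]] E.
    move: Ss; congr (S _ _); apply: eq_from_tnth => j.
    by have := congr1 (fun t => tnth t j) E; rewrite !tnth_map => -[].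
  have := congr1 (fun t => tnth t (Ordinal R0)) E; rewrite !tnth_map.
  by case: (tnth s' _) => [z|//]; apply: no0 z _.
have facts_r R (s : (arity R).-tuple ('I_0 + X)) : 0 < arity R ->
    glue S a A R (map_tuple g s) -> A R s.
  move=> R0 [[s' Ss]|[s' As]] E.
    have := congr1 (fun t => tnth t (Ordinal R0)) E; rewrite !tnth_map.
    by case: (tnth s _) => [z|//]; apply: no0 z _.
  move: As; congr (A _ _); apply: eq_from_tnth => j.
  have := congr1 (fun t => tnth t j) E; rewrite !tnth_map.
  case: (tnth s j) => [z|x]; first exact: no0 z _.
  by case: (tnth s' j) => [z|x'] /=; [exact: no0 z _|move=> [->]].
have val_l H (HA : labelling _) x b : has_value (glue S a A) (join H HA) (inl x) b ->
    has_value S H x b.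
  case=> i' Pi bH; exists i' => //; apply: (facts_l (block_sym i')) => //.
  by move: Pi; congr (glue _ _ _ _); apply: val_inj.
have val_r H HA z b : has_value (glue S a A) (join H (HA \o inr)) (g z) b ->
    has_value A HA z b.
  case: z => [z|x]; first exact: no0 z _.
  case=> i' Pi bH; exists i' => //; apply: (facts_r (block_sym i')) => //.
  by move: Pi; congr (glue _ _ _ _); apply: val_inj.
elim: Qs => [|[] Qs IH] i H HA /=.
- move=> nS nA [c [t [v [[[s Ss E]|[s As E]] nK tv]]]].
    apply: nS; exists c, s, v; split=> // j.
    by apply: (val_l _ (HA \o inr)); have := tv j; rewrite E tnth_map; exact.
  apply: nA; exists c, s, v; split=> // j.
  by apply: val_r; have := tv j; rewrite E tnth_map; exact.
- move=> [w [w0 ww]] [w' [w'0 ww']]; exists (join w (w' \o inr)); split.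
    by case=> x /=.
  have := IH _ _ _ ww ww'; congr (wins _ _ _ _).
  by apply/funext => -[x|x]; apply/funext => j; rewrite /relabel /=; case: ifP.
- move=> ww ww' w lw.
  have lS : legal S (w \o inl).
    move=> x y b b' bx by' nb; have [] := lw _ _ _ _ bx by' nb => e; [left|right];
    by apply: (facts_l distinct_sym) => //; move: e; congr (glue _ _ _ _); apply: val_inj.
  have lA : legal A (w \o g).
    move=> x y b b' bx by' nb; have [] := lw _ _ _ _ bx by' nb => e; [left|right];
    by apply: (facts_r distinct_sym) => //; move: e; congr (glue _ _ _ _); apply: val_inj.
  have := IH _ _ _ (ww _ lS) (ww' _ lA); congr (wins _ _ _ _).
  by apply/funext => -[x|x]; apply/funext => j; rewrite /relabel /=; case: ifP.
Qed.

End Game.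

Arguments glue [kappa n T X k] S a A R t.

(** * Game types and gluing *)

Section Types.

Variables (kappa : signature) (B : finType) (KB : structure kappa B) (n k : nat).

Notation sigma := (game_sig kappa n).

Definition width : nat := \max_(R : sigma) arity R.

Lemma arity_width (R : sigma) : arity R <= width.
Proof. exact: (@leq_bigmax sigma (@arity sigma) R). Qed.

(* The facts, equalities and labels of [k] fixed points and [width] further ones;
   [width] points suffice to see a constraint or an illegal pair. *)
Definition diagram : finType :=
  ({set {R : sigma & (arity R).-tuple ('I_k + 'I_width)}}
   * {set ('I_k + 'I_width) * ('I_k + 'I_width)}
   * {ffun ('I_k + 'I_width) * 'I_n -> {set B}})%type.

Definition diagram_of (S : structure sigma nat) (H : labelling B nat)
    (w : 'I_k + 'I_width -> nat) : diagram :=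
  (finset (fun f => `[< S (tag f) (map_tuple w (tagged f)) >]),
   finset (fun p => w p.1 == w p.2),
   [ffun p => H (w p.1) (val p.2)]).

Definition profile (S : structure sigma nat) (a : 'I_k -> nat)
    (H : labelling B nat) : {set diagram} :=
  finset (fun d => `[< exists u, diagram_of S H (join a u) = d >]).

Fixpoint game_types (Qs : seq quant) : finType :=
  match Qs with
  | [::] => {set diagram}
  | _ :: Qs' => ({set diagram} * {set game_types Qs'})%type
  end.

(** An Ehrenfeucht-Fraisse type of rank [size Qs] whose moves are labellings. The kind of quantifier
    does not enter; whether a move is admissible after gluing is read off the profiles. *)
Fixpoint game_type (Qs : seq quant) (i : nat) (S : structure sigma nat)
    (a : 'I_k -> nat) (H : labelling B nat) : game_types Qs :=
  match Qs with
  | [::] => profile S a H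
  | _ :: Qs' =>
      (profile S a H,
       finset (fun q => `[< exists w, game_type Qs' i.+1 S a (relabel H i w) = q >]))
  end.

Lemma game_type_profile Qs i S a H S' a' H' :
  game_type Qs i S a H = game_type Qs i S' a' H' -> profile S a H = profile S' a' H'.
Proof. by case: Qs => //= _ Qs [->]. Qed.

Lemma profile_match S a H S' a' H' :
  profile S a H = profile S' a' H' ->
  forall u, exists u',
    diagram_of S H (join a u) = diagram_of S' H' (join a' u').
Proof.
move=> E u.
have : diagram_of S H (join a u) \in profile S a H.
  by rewrite finset.inE; apply/asboolP; exists u.
by rewrite E finset.inE => /asboolP[u' <-]; exists u'.
Qed.

Variable X : Type.

Definition on_left (T T' : Type) (w : T -> T') (z : T + X) : T' + X :=
  match z with inl z => inl (w z) | inr x => inr x end.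

Lemma tuple_cover (a : 'I_k -> nat) (m : nat) (t : m.-tuple (nat + X)) :
  m <= width ->
  exists u (s : m.-tuple ('I_k + 'I_width + X)), t = map_tuple (on_left (join a u)) s.
Proof.
move=> mw.
exists (fun j => if nth (inl 0) t j is inl x then x else 0).
exists [tuple match tnth t j with
  inl _ => inl (inr (widen_ord mw j)) | inr x => inr x end | j < m].
apply: eq_from_tnth => j; rewrite tnth_map tnth_mktuple.
by case E: (tnth t j) => [x|x] //=; rewrite -tnth_nth E.
Qed.

(** Facts of [S] are recorded in the diagram. For a fact of [A] the recorded equalities are used
    instead: they tell which points of [S] are named points of [A]. *)
Lemma glue_transfer (S S' : structure sigma nat) a a' H H' u u'
    (A : structure sigma ('I_k + X)) (R : sigma)
    (s : (arity R).-tuple ('I_k + 'I_width + X)) :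
  diagram_of S H (join a u) = diagram_of S' H' (join a' u') ->
  glue S a A R (map_tuple (on_left (join a u)) s) ->
  glue S' a' A R (map_tuple (on_left (join a' u')) s).
Proof.
move=> [Ef Ee _] [[p Sp E]|[p Ap E]]; [left|right].
  have Ej j : on_left (join a u) (tnth s j) = inl (tnth p j).
    by have := congr1 (fun t => tnth t j) E; rewrite !tnth_map.
  have [q Eq] : exists q : (arity R).-tuple ('I_k + 'I_width), s = map_tuple inl q.
    have sq j : {q | tnth s j = inl q}.
      by move: (Ej j); case: (tnth s j) => [q|//] _; exists q.
    exists [tuple sval (sq j) | j < arity R]; apply: eq_from_tnth => j.
    by rewrite tnth_map tnth_mktuple; exact: (svalP (sq j)).
  subst s; exists (map_tuple (join a' u') q); last first.
    by apply: eq_from_tnth => j; rewrite !tnth_map.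
  have := congr1 (fun D => Tagged (fun R : sigma => (arity R).-tuple _) q \in (D : {set _})) Ef.
  rewrite !finset.inE /= => Eq.
  apply/asboolP; rewrite -Eq; apply/asboolP.
  move: Sp; congr (S _ _); apply: eq_from_tnth => j.
  by have := Ej j; rewrite !tnth_map => -[].
exists p => //; apply: eq_from_tnth => j; rewrite !tnth_map.
have := congr1 (fun t => tnth t j) E; rewrite !tnth_map.
case: (tnth s j) => [z|x]; case: (tnth p j) => [l|y] //=.
move=> [zl]; congr inl.
have := congr1 (fun D => (z, inl l) \in (D : {set _})) Ee.
by rewrite !finset.inE /= zl eqxx => /esym/eqP.
Qed.

Lemma label_transfer S S' a a' H H' u u' (HA : labelling B X) z (i : 'I_n) :
  diagram_of S H (join a u) = diagram_of S' H' (join a' u') ->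
  join H HA (on_left (join a u) z) i = join H' HA (on_left (join a' u') z) i.
Proof.
by case: z => [z|//] [_ _ /ffunP/(_ (z, i))]; rewrite !ffunE.
Qed.

Lemma value_transfer (S S' : structure sigma nat) a a' H H' u u'
    (A : structure sigma ('I_k + X)) (HA : labelling B X) z b :
  diagram_of S H (join a u) = diagram_of S' H' (join a' u') ->
  has_value (glue S a A) (join H HA) (on_left (join a u) z) b ->
  has_value (glue S' a' A) (join H' HA) (on_left (join a' u') z) b.
Proof.
move=> E [i Pi bi]; exists i; last by rewrite -(label_transfer _ _ _ E).
have := @glue_transfer _ _ _ _ _ _ _ _ A (block_sym kappa i) [tuple z] E.
rewrite /in_block.
have e w : map_tuple (on_left w) [tuple z] = [tuple on_left w z] by apply: val_inj.
by rewrite !e; apply.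
Qed.

Lemma apart_transfer (S S' : structure sigma nat) a a' H H' u u'
    (A : structure sigma ('I_k + X)) x y :
  diagram_of S H (join a u) = diagram_of S' H' (join a' u') ->
  apart (glue S a A) (on_left (join a u) x) (on_left (join a u) y) ->
  apart (glue S' a' A) (on_left (join a' u') x) (on_left (join a' u') y).
Proof.
have e w z z' : [tuple on_left w z; on_left w z'] = map_tuple (on_left w) [tuple z; z'].
  by move=> *; apply: val_inj.
by move=> E []; rewrite e => /(glue_transfer E) h; [left|right]; rewrite e.
Qed.

(** Feferman-Vaught composition: a move on one glued structure splits into its part on [nat],
    matched on the other side by equality of types, and its part on [X], which is copied. The
    condition on [i] keeps all blocks played below [n], where diagrams record labels. *)
Lemma glue_wins (A : structure sigma ('I_k + X)) S a S' a' Qs :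
  forall i H H' (HA : labelling B X), i + size Qs = n ->
  game_type Qs i S a H = game_type Qs i S' a' H' ->
  wins KB (glue S a A) Qs i (join H HA) ->
  wins KB (glue S' a' A) Qs i (join H' HA).
Proof.
have rel T (H : labelling B T) (HA : labelling B X) i w w' :
    relabel (join H HA) i (join w w') = join (relabel H i w) (relabel HA i w').
  by apply/funext => -[x|x].
have eqjoin T (w : T + X -> {set B}) : w = join (w \o inl) (w \o inr).
  by apply/funext => -[].
elim: Qs => [|[] Qs IH] i H H' HA En Et.
- move=> nv [c [t [v [Gt nK tv]]]]; apply: nv.
  have Ep : profile S' a' H' = profile S a H := esym (game_type_profile Et).
  have [u' [s Es]] := tuple_cover a' t (arity_width (constr n c)).
  have [u Eu] := profile_match Ep u'; subst t.
  exists c, (map_tuple (on_left (join a u)) s), v; split=> //.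
    exact: glue_transfer Eu Gt.
  by move=> j; have := tv j; rewrite !tnth_map; apply: value_transfer.
- move=> [w [w0 ww]].
  move: Et => /= -[_ Et].
  have : game_type Qs i.+1 S a (relabel H i (w \o inl)) \in
      finset (fun q => `[< exists w, game_type Qs i.+1 S a (relabel H i w) = q >]).
    by rewrite finset.inE; apply/asboolP; exists (w \o inl).
  rewrite Et finset.inE => /asboolP[w' Ew].
  have ilt : i < n by rewrite -En /= -addSnnS leq_addr.
  (* Every point occurs in some diagram, and diagrams record labels, so the matched move has
     nonempty labels as well. *)
  exists (join w' (w \o inr)); split.
    move=> [x|x] /=; last exact: w0.
    have [u' [s /(congr1 (fun t => tnth t ord0)) Es]] :=
      tuple_cover a' [tuple inl x : nat + X] (leq_trans (ltn0Sn 1) (arity_width (distinct_sym kappa n))).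
    have [u Eu] := profile_match (game_type_profile Ew) u'.
    rewrite tnth_map /= in Es; case: (tnth s ord0) Es => [z|//] [->].
    have := label_transfer (relabel HA i (w \o inr)) (inl z) (Ordinal ilt) Eu.
    by rewrite /= /relabel eqxx /= => ->; exact: w0.
  rewrite rel; apply: IH (esym Ew) _; first by rewrite -En addSnnS.
  by rewrite -rel -eqjoin.
- move=> ww w' lw'.
  move: Et => /= -[_ Et].
  have : game_type Qs i.+1 S' a' (relabel H' i (w' \o inl)) \in
      finset (fun q => `[< exists w, game_type Qs i.+1 S' a' (relabel H' i w) = q >]).
    by rewrite finset.inE; apply/asboolP; exists (w' \o inl).
  rewrite -Et finset.inE => /asboolP[w Ew].
  have ilt : i < n by rewrite -En /= -addSnnS leq_addr.
  (* Legality concerns two points at a time, and [width] is at least 2 because of the distinctness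
     symbol. *)
  have lw : legal (glue S a A) (join w (w' \o inr)).
    move=> x y b b' bx by' nb.
    have [u [s Es]] := tuple_cover a [tuple x; y] (arity_width (distinct_sym kappa n)).
    have [u' Eu] := profile_match (game_type_profile Ew) u.
    have Ex := congr1 (fun t => tnth t ord0) Es.
    have Ey := congr1 (fun t => tnth t (lift ord0 ord0)) Es.
    rewrite !tnth_map /= in Ex Ey.
    have lab z : join w (w' \o inr) (on_left (join a u) z) = w' (on_left (join a' u') z).
      have := label_transfer (relabel HA i (w' \o inr)) z (Ordinal ilt) Eu.
      rewrite -!rel /relabel /= eqxx => ->.
      by case: z.
    have -> : x = on_left (join a u) (tnth s ord0) by exact: Ex.
    have -> : y = on_left (join a u) (tnth s (lift ord0 ord0)) by exact: Ey.
    apply: (apart_transfer (esym Eu)); apply: (lw' _ _ b b') => //.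
      by rewrite -lab -Ex.
    by rewrite -lab -Ey.
  rewrite [w']eqjoin rel; apply: IH Ew _; first by rewrite -En addSnnS.
  by rewrite -rel; apply: ww.
Qed.

End Types.

(** * The omega-categorical structure *)

Section Limit.

Variables (kappa : signature) (B : finType) (KB : structure kappa B) (b0 : B).
Variable Q : seq quant.

Notation n := (size Q).
Notation sigma := (game_sig kappa n).

Definition won (T : Type) (S : structure sigma T) : Prop :=
  wins KB S Q 0 (@unlabelled B T).

Lemma won_hom (T U : Type) (S : structure sigma T) (S' : structure sigma U) h :
  homomorphism S S' h -> won S' -> won S.
Proof. by move=> hh; apply: (wins_hom hh) => x j; apply: finset.sub0set. Qed.

Lemma won_no_facts (T : Type) (S : structure sigma T) :
  (forall R t, ~ S R t) -> won S.
Proof.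
move=> nS; suff: forall Qs i (H : labelling B T), wins KB S Qs i H by apply.
elim=> [|[] Qs IH] i H /=.
- by case=> c [t [v [/nS]]].
- exists (fun _ => finset.setT); split; last exact: IH.
  by move=> x; apply/set0Pn; exists b0; rewrite finset.inE.
- by move=> w _; apply: IH.
Qed.

Lemma join_unlabelled (T X : Type) :
  @unlabelled B (T + X) = join (@unlabelled B T) (@unlabelled B X).
Proof. by apply/funext => -[]. Qed.

Definition nat_fact : eqType := {R : sigma & (arity R).-tuple nat}.

Definition of_facts (l : seq nat_fact) : structure sigma nat :=
  fun R t => Tagged (fun R : sigma => (arity R).-tuple nat) t \in l.

Arguments of_facts l R t : clear implicits.

Definition map_fact (X Y : Type) (h : X -> Y) (f : {R : sigma & (arity R).-tuple X}) :
    {R : sigma & (arity R).-tuple Y} :=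
  Tagged (fun R : sigma => (arity R).-tuple Y) (map_tuple h (tagged f)).

(* A finite structure to be glued along a tuple of numbers; its points are the
   [k] positions of the tuple and [m] fresh points. *)
Definition request : countType :=
  {k : nat & {m : nat &
    (k.-tuple nat * {set {R : sigma & (arity R).-tuple ('I_k + 'I_m)}})%type}}.

Definition placed (M : nat) (q : request) : seq nat_fact :=
  let: existT k (existT m (a, F)) := q in
  [seq map_fact (join (tnth a) (fun l : 'I_m => M + l)) f | f <- enum F].

Definition fact_bound (l : seq nat_fact) : nat :=
  (\max_(f <- l) \max_(x <- tagged f) x).+1.

Definition request_bound (q : request) : nat :=
  let: existT k (existT m (a, F)) := q in (\max_(x <- a) x).+1.

Lemma fact_bound_lt l f x : f \in l -> x \in tval (tagged f) -> x < fact_bound l.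
Proof.
move=> fl xf; rewrite ltnS.
apply: leq_trans (leq_bigmax_seq (P := xpredT) (F := fun f : nat_fact => \max_(x <- tagged f) x) f fl isT).
exact: (leq_bigmax_seq (P := xpredT) (F := id) x xf isT).
Qed.

(** A request gets its turn at the stage given by its code. One attempt is enough: since stages only
    grow, a gluing that is not won now is not won later. *)
Fixpoint stage (j : nat) : seq nat_fact :=
  match j with
  | 0 => [::]
  | j'.+1 =>
      if unpickle j' is Some q then
        let l := placed (maxn (fact_bound (stage j')) (request_bound q)) q ++ stage j' in
        if `[< won (of_facts l) >] then l else stage j'
      else stage j'
  end.

Definition limit : structure sigma nat :=
  fun R t => exists j, of_facts (stage j) R t.

Arguments limit R t : clear implicits.

Lemma stage_won j : won (of_facts (stage j)).
Proof.
elim: j => [|j IH] /=; first exact: won_no_facts.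
by case: unpickle => //= q; case: asboolP.
Qed.

Lemma stage_le i j : i <= j -> {subset stage i <= stage j}.
Proof.
elim: j => [|j IH]; first by rewrite leqn0 => /eqP ->.
rewrite leq_eqVlt => /predU1P[-> //|/IH ij] x /ij xj /=.
by case: unpickle => //= q; case: asboolP => // _; rewrite mem_cat xj orbT.
Qed.

Lemma stage_hom i j : i <= j -> homomorphism (of_facts (stage i)) (of_facts (stage j)) id.
Proof.
move=> /stage_le ij R t; have -> : map_tuple id t = t; last exact: ij.
by apply: eq_from_tnth => l; rewrite tnth_map.
Qed.

Lemma limit_stage (l : seq nat_fact) :
  (forall f, f \in l -> limit (tag f) (tagged f)) -> exists j, {subset l <= stage j}.
Proof.
elim: l => [|f l IH] hl; first by exists 0.
have [j fj] := hl f (mem_head _ _).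
have [|j' lj] := IH; first by move=> g gl; apply: hl; rewrite in_cons gl orbT.
exists (maxn j j') => g; rewrite in_cons => /predU1P[->|/lj].
  by move: fj; rewrite /of_facts; case: f {hl} => R t; apply/stage_le/leq_maxl.
exact/stage_le/leq_maxr.
Qed.

Lemma limit_hom_facts l h : homomorphism (of_facts l) limit h ->
  exists j, homomorphism (of_facts l) (of_facts (stage j)) h.
Proof.
move=> hh.
have [f|j lj] := @limit_stage (map (map_fact h) l).
  by case/mapP => -[R t] fl -> /=; apply: hh.
exists j => R t tl; apply: lj.
exact: (map_f (map_fact h) tl).
Qed.

Lemma limit_hom_fin (Y : finType) (A : structure sigma Y) h :
  homomorphism A limit h -> exists j, homomorphism A (of_facts (stage j)) h.
Proof.
move=> hh.
pose F := [seq map_fact h f |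
  f : {R : sigma & (arity R).-tuple Y} <- enum (finset (fun f => `[< A (tag f) (tagged f) >]))].
have [f|j Fj] := @limit_stage F.
  case/mapP => g; rewrite mem_enum finset.inE => /asboolP Ag -> /=.
  exact: hh.
exists j => R t At; apply: Fj.
apply: (map_f (map_fact h) (x := Tagged (fun R : sigma => (arity R).-tuple Y) t)).
by rewrite mem_enum finset.inE; apply/asboolP.
Qed.

(** * Realization of finite structures in the limit *)

Section Realization.

Variables (k m : nat).

Definition realizes (a : 'I_k -> nat) (A : structure sigma ('I_k + 'I_m)) : Prop :=
  exists h : 'I_m -> nat, homomorphism A limit (join a h).

(** The gluing maps into a later stage, by [f] on the old points and by [g] on the fresh ones, and
    every stage is won. *)
Lemma glue_stage_won j i f g (a : 'I_k -> nat) (A : structure sigma ('I_k + 'I_m)) :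
  homomorphism (of_facts (stage i)) (of_facts (stage j)) f ->
  homomorphism A limit (join (f \o a) g) ->
  won (glue (of_facts (stage i)) a A).
Proof.
move=> hf hA.
have [j' hj'] := limit_hom_fin hA.
apply: (won_hom (S' := of_facts (stage (maxn j j'))) (h := join f g)); last exact: stage_won.
apply: glue_hom.
  by move=> R t /hf; apply/stage_le/leq_maxl.
by move=> R t /hj'; apply/stage_le/leq_maxr.
Qed.

Lemma realizes_won a A : realizes a A -> forall i, won (glue (of_facts (stage i)) a A).
Proof. by move=> [h hA] i; apply: (glue_stage_won (stage_hom (leqnn i)) hA). Qed.

(** The structure formed when the request for [A] along [a] has its turn maps to the gluing at that
    stage, so it is won and is kept. *)
Lemma won_realizes a (A : structure sigma ('I_k + 'I_m)) :
  (forall i, won (glue (of_facts (stage i)) a A)) ->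
  exists h : 'I_m -> nat, [/\ injective h, forall l j, h l <> a j
    & homomorphism A limit (join a h)].
Proof.
move=> wA.
pose q : request := existT _ k (existT _ m ([tuple a j | j < k],
  finset (fun f : {R : sigma & (arity R).-tuple ('I_k + 'I_m)} => `[< A (tag f) (tagged f) >]))).
pose i := pickle q.
pose M := maxn (fact_bound (stage i)) (request_bound q).
have aM j : a j < M.
  rewrite leq_max [X in _ || X]ltnS; apply/orP; right.
  apply: (leq_bigmax_seq (P := xpredT) (F := id) _ _ isT).
  by rewrite -[a j](tnth_mktuple a); apply: mem_tnth.
pose g (l : 'I_m) : nat := M + l.
have Eg : placed M q = [seq map_fact (join a g) f |
    f <- enum (finset (fun f : {R : sigma & (arity R).-tuple ('I_k + 'I_m)} => `[< A (tag f) (tagged f) >]))].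
  rewrite /placed /=.
  by have -> : tnth [tuple a j | j < k] = a by apply/funext => j; rewrite tnth_mktuple.
have E : stage i.+1 = placed M q ++ stage i.
  rewrite /= pickleK -/M; case: asboolP => // -[].
  (* Old points lie below [M] and the fresh ones are the [M + l]; the remaining numbers occur in no
     fact, so their image is arbitrary. *)
  pose phi x := if x < M then inl x else
    if insub (x - M) is Some l then inr l else inl x : nat + 'I_m.
  apply: won_hom (wA i); instantiate (1 := phi).
  move=> R t; rewrite /of_facts mem_cat => /orP[|ti]; last first.
    left; exists t => //; apply: eq_from_tnth => j; rewrite !tnth_map /phi ifT //.
    rewrite leq_max; apply/orP; left.
    exact: (fact_bound_lt ti (mem_tnth j t)).
  rewrite Eg => /mapP[[R' s]]; rewrite mem_enum finset.inE => /asboolP /= As.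
  rewrite /map_fact /= => /eqP; rewrite -tag_eqE /tag_eq /=.
  case/andP => /eqP ER; subst R'; rewrite tagged_asE => /eqP ->.
  right; exists s => //; apply: eq_from_tnth => j; rewrite !tnth_map /phi.
  case: (tnth s j) => [z|z] /=; first by rewrite aM.
  rewrite ltnNge leq_addr /= addKn insubT //= => zm.
  by congr inr; apply: val_inj.
exists g; split.
- by move=> x y /addnI /val_inj.
- by move=> l j e; have := aM j; rewrite -e ltnNge leq_addr.
move=> R t At; exists i.+1; rewrite E /of_facts mem_cat Eg.
apply/orP; left.
apply: (map_f (map_fact (join a g)) (x := Tagged (fun R : sigma => (arity R).-tuple _) t)).
by rewrite mem_enum finset.inE; apply/asboolP.
Qed.

End Realization.

(** A finite structure with [k] named points is a primitive positive formula in [k] free variables,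
    so the first clause compares primitive positive types. *)
Definition same_type (k : nat) (a b : 'I_k -> nat) : Prop :=
  (forall m (A : structure sigma ('I_k + 'I_m)), realizes a A <-> realizes b A) /\
  (forall j j', a j = a j' <-> b j = b j').

Definition type_at (k i : nat) (a : 'I_k -> nat) : game_types kappa B n k Q :=
  game_type Q 0 (of_facts (stage i)) a (@unlabelled B nat).

Lemma type_at_won k m (a b : 'I_k -> nat) i j (A : structure sigma ('I_k + 'I_m)) :
  type_at i a = type_at j b ->
  won (glue (of_facts (stage i)) a A) -> won (glue (of_facts (stage j)) b A).
Proof. by rewrite /won !join_unlabelled; apply: glue_wins. Qed.

Lemma glue_mono k m (a : 'I_k -> nat) i j (A : structure sigma ('I_k + 'I_m)) :
  i <= j ->
  won (glue (of_facts (stage j)) a A) -> won (glue (of_facts (stage i)) a A).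
Proof.
move=> ij; apply: (won_hom (h := id)) => R t [[s /(stage_le ij) Ss ->]|[s As ->]].
  by left; exists s => //; apply: eq_from_tnth => l; rewrite !tnth_map.
by right; exists s => //; apply: eq_from_tnth => l; rewrite !tnth_map.
Qed.

(* By finiteness some game type of [a] is attained at cofinally many stages. *)
Lemma stable_stage k (a : 'I_k -> nat) :
  exists i, forall m (A : structure sigma ('I_k + 'I_m)),
    won (glue (of_facts (stage i)) a A) -> realizes a A.
Proof.
have [th cof] : exists th, forall j, exists2 i, j <= i & type_at i a = th.
  apply: contrapT => /forallNP nex.
  have /choice[f fP] : forall th, exists j, forall i, j <= i -> type_at i a <> th.
    move=> th; have /existsNP[j nj] := nex th.
    by exists j => i ji E; apply: nj; exists i.
  (* At the stage [\max_th f th] every game type is excluded, including the one attained there. *)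
  apply: (fP _ (\max_th f th) _ (erefl _)).
  exact: (leq_bigmax (type_at _ a)).
have [i _ Ei] := cof 0.
exists i => m A wA.
have [|h [_ _ hA]] := @won_realizes k m a A; last by exists h.
move=> j; have [i' ji Ei'] := cof j.
by apply: glue_mono ji _; apply: type_at_won wA; rewrite Ei Ei'.
Qed.

(** A stage turned into a formula about [a]: the numbers below [M] become variables, and those
    occurring in [a] are also available through their positions. *)
Definition stage_diagram (k M i : nat) (a : 'I_k -> nat) :
    structure sigma ('I_k + 'I_M) :=
  fun R t => of_facts (stage i) R (map_tuple (join a val) t).
Arguments stage_diagram [k] M i a R t.

(** If [b] realizes the diagram of a stage around [a], this stage maps to the limit with [a] going
    to [b]. A copy of [A] at [b] then extends this map to the gluing of [A] at [a]. *)
Lemma diagram_glue_won k m M i (a b : 'I_k -> nat) (A : structure sigma ('I_k + 'I_m)) h :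
  (forall j j', a j = a j' -> b j = b j') ->
  fact_bound (stage i) <= M.+1 ->
  homomorphism (stage_diagram M.+1 i a) limit (join b h) ->
  realizes b A -> won (glue (of_facts (stage i)) a A).
Proof.
move=> ab bM hS [g hA].
(* Points of [a] are sent to a position, hence to points of [b]; by [ab] the choice among equal
   positions is immaterial. *)
pose c x : 'I_k + 'I_M.+1 :=
  if [pick j | a j == x] is Some j then inl j else inr (inord x).
have ca x : x < M.+1 -> join a val (c x) = x.
  move=> xM; rewrite /c; case: pickP => [j /eqP //|_] /=.
  by rewrite inordK.
have hf : homomorphism (of_facts (stage i)) limit (join b h \o c).
  move=> R t ti.
  have -> : map_tuple (join b h \o c) t = map_tuple (join b h) (map_tuple c t).
    by apply: eq_from_tnth => j; rewrite !tnth_map.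
  apply: hS; rewrite /stage_diagram.
  have -> // : map_tuple (join a val) (map_tuple c t) = t.
  apply: eq_from_tnth => j; rewrite !tnth_map ca //.
  exact: leq_trans (fact_bound_lt ti (mem_tnth j t)) bM.
have [j hj] := limit_hom_facts hf.
apply: (glue_stage_won hj) => R t /hA.
congr (limit _ _); apply: eq_from_tnth => l; rewrite !tnth_map.
case: (tnth t l) => //= z; rewrite /c; case: pickP => [j' /eqP/ab /= -> //|/(_ z)].
by rewrite eqxx.
Qed.

Lemma realizes_diagram k M i (a : 'I_k -> nat) : realizes a (stage_diagram M i a).
Proof. by exists val => R t ti; exists i. Qed.

(* Finite parts of the limit around [a] are themselves realized by [a], hence by
   [b]; so whatever is glued to [b] can also be glued to [a]. *)
Lemma type_maximal k (a b : 'I_k -> nat) :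
  (forall j j', a j = a j' -> b j = b j') ->
  (forall m (A : structure sigma ('I_k + 'I_m)), realizes a A -> realizes b A) ->
  forall m (A : structure sigma ('I_k + 'I_m)), realizes b A -> realizes a A.
Proof.
move=> ab sub m A bA.
have [|h [_ _ hA]] := @won_realizes k m a A; last by exists h.
move=> i; have [h hh] := sub _ _ (realizes_diagram (fact_bound (stage i)).+1 i a).
exact: diagram_glue_won hh bA.
Qed.

(** * Back-and-forth and definable relations *)

Lemma extend_max T k (a : 'I_k -> T) x : extend a x ord_max = x.
Proof. by rewrite /extend unlift_none. Qed.

Lemma extend_lift T k (a : 'I_k -> T) x j : extend a x (lift ord_max j) = a j.
Proof. by rewrite /extend liftK. Qed.

(** A new point [x] is matched by realizing around [b] the diagram of a stage that is stable for [a]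
    and [x]. Stability carries realized structures back from [b] to [a], and maximality of types
    gives the converse. *)
Lemma same_type_extend k (a b : 'I_k -> nat) x :
  same_type a b -> exists y, same_type (extend a x) (extend b y).
Proof.
move=> [ab eab]; have [[j ->]|xa] := pselect (exists j, x = a j).
  exists (b j); split; last first.
    move=> l l'; case: (unliftP ord_max l) => [l1|] ->; case: (unliftP ord_max l') => [l2|] ->;
    by rewrite ?extend_max ?extend_lift.
  move=> m A.
  (* The extra position is folded onto position [j], which reduces the claim to structures glued
     along [a] and [b]. *)
  pose pi (z : 'I_k.+1 + 'I_m) : 'I_k + 'I_m :=
    match z with inl l => inl (odflt j (unlift ord_max l)) | inr y => inr y end.
  pose A' : structure sigma ('I_k + 'I_m) :=
    fun R t => exists2 s, A R s & t = map_tuple pi s.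
  have red (c : 'I_k -> nat) : realizes (extend c (c j)) A <-> realizes c A'.
    have Ec h z : join (extend c (c j)) h z = join c h (pi z).
      by case: z => //= l; rewrite /extend; case: unlift.
    split=> -[h hA]; exists h => R t.
      case=> s /hA As ->; move: As; congr (limit _ _).
      by apply: eq_from_tnth => l; rewrite !tnth_map Ec.
    move=> At; have /hA : A' R (map_tuple pi t) by exists t.
    congr (limit _ _); by apply: eq_from_tnth => l; rewrite !tnth_map Ec.
  by rewrite !red.
have [i st] := stable_stage (extend a x).
pose M := maxn (fact_bound (stage i)) x.
have xM : x < M.+1 by rewrite ltnS leq_maxr.
have /ab bd := realizes_diagram M.+1 i a.
(* Choosing the realization fresh makes [y] differ from all points of [b], as [x] differs from all
   points of [a]. *)
have [h [hi hf hh]] := won_realizes (realizes_won bd).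
pose y := h (Ordinal xM); exists y.
have eqp l l' : extend a x l = extend a x l' <-> extend b y l = extend b y l'.
  have xa' z : a z <> x by move=> e; apply: xa; exists z.
  case: (unliftP ord_max l) => [l1|] ->; case: (unliftP ord_max l') => [l2|] ->;
    rewrite ?extend_max ?extend_lift //.
    by split=> [/xa'//|e]; case: (hf (Ordinal xM) l1).
  by split=> [/esym/xa'//|/hf].
have diag : homomorphism (stage_diagram M.+1 i (extend a x)) limit (join (extend b y) h).
  pose pi (z : 'I_k.+1 + 'I_M.+1) : 'I_k + 'I_M.+1 :=
    match z with
    | inl l => if unlift ord_max l is Some l' then inl l' else inr (Ordinal xM)
    | inr z => inr z
    end.
  move=> R t tS; have /hh : stage_diagram M.+1 i a R (map_tuple pi t).
    move: tS; rewrite /stage_diagram; congr (of_facts _ _ _).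
    apply: eq_from_tnth => l; rewrite !tnth_map; case: (tnth t l) => //= z.
    by rewrite /extend; case: unlift.
  congr (limit _ _).
  apply: eq_from_tnth => l; rewrite !tnth_map; case: (tnth t l) => //= z.
  by rewrite /extend; case: unlift.
have sub m (A : structure sigma ('I_k.+1 + 'I_m)) :
    realizes (extend b y) A -> realizes (extend a x) A.
  move=> bA; apply: st; apply: (diagram_glue_won _ _ diag bA).
    by move=> l l' /eqp.
  by rewrite ltnW // ltnS leq_maxl.
split=> // m A; split; last exact: sub.
by apply: type_maximal m A => [l l' /eqp|].
Qed.

Lemma same_type_sym k (a b : 'I_k -> nat) : same_type a b -> same_type b a.
Proof. by move=> [h e]; split=> *; [rewrite h|rewrite e]. Qed.

(** A single fact on the named points is a structure to be realized without fresh points. *)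
Lemma same_type_rel k (a b : 'I_k -> nat) R (t : (arity R).-tuple 'I_k) :
  same_type a b -> limit R (map_tuple a t) -> limit R (map_tuple b t).
Proof.
move=> [ab _] La.
pose A : structure sigma ('I_k + 'I_0) :=
  fun R' s => Tagged (fun R : sigma => (arity R).-tuple ('I_k + 'I_0)) s =
              Tagged (fun R : sigma => (arity R).-tuple ('I_k + 'I_0)) (map_tuple inl t).
have e (c : 'I_k -> nat) h : map_tuple (join c h) (map_tuple (@inl _ 'I_0) t) = map_tuple c t.
  by apply: eq_from_tnth => j; rewrite !tnth_map.
have /ab[h hA] : realizes a A.
  exists (fun _ => 0) => R' s /eqP; rewrite -tag_eqE /tag_eq /=.
  case/andP => /eqP ER; subst R'; rewrite tagged_asE => /eqP ->.
  by rewrite e.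
by rewrite -(e b h); apply: hA.
Qed.

Lemma same_type_sat (V : 'I_0 -> set nat) k (phi : fo sigma 0 k) :
  forall a b : 'I_k -> nat, same_type a b -> sat_fo limit V a phi -> sat_fo limit V b phi.
Proof.
suff: forall a b : 'I_k -> nat, same_type a b -> sat_fo limit V a phi <-> sat_fo limit V b phi.
  by move=> h a b /h[].
elim: phi => {k} [k [|x y|R t]|k []//|k p IH|k p IHp q IHq|k p IHp q IHq|k p IH|k p IH] a b ab //=.
- by case: ab => _; apply.
- by split; apply: same_type_rel => //; apply: same_type_sym.
- by rewrite (IH _ _ ab).
- by rewrite (IHp _ _ ab) (IHq _ _ ab).
- by rewrite (IHp _ _ ab) (IHq _ _ ab).
- split=> h x.
    have [y /same_type_sym xy] := same_type_extend x (same_type_sym ab).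
    by apply/(IH _ _ xy).
  have [y /same_type_sym xy] := same_type_extend x ab.
  by apply/(IH _ _ xy).
- split=> -[x h].
    by have [y xy] := same_type_extend x ab; exists y; apply/(IH _ _ xy).
  by have [y xy] := same_type_extend x (same_type_sym ab); exists y; apply/(IH _ _ xy).
Qed.

Definition invariant (k : nat) (a : 'I_k -> nat) :
    ({set game_types kappa B n k Q} * {set 'I_k * 'I_k})%type :=
  (finset (fun th => `[< exists i, type_at i a = th >]),
   finset (fun p => a p.1 == a p.2)).

(** What [c] realizes is won when glued to [c] at every stage. Each game type of [d] occurs for [c]
    at some stage, so the gluing to [d] is won at every stage too, hence realized. *)
Lemma invariant_same_type k (a b : 'I_k -> nat) :
  invariant a = invariant b -> same_type a b.
Proof.
suff half (c d : 'I_k -> nat) : invariant c = invariant d ->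
    forall m (A : structure sigma ('I_k + 'I_m)), realizes c A -> realizes d A.
  move=> E; split=> [m A|j j'].
    by split; apply: half.
  have := congr1 (fun s => (j, j') \in (s : {set _})) (congr1 snd E).
  by rewrite !finset.inE /= => e; split=> /eqP h; apply/eqP; rewrite ?e // -e.
move=> [Et _] m A cA.
have [|h [_ _ hA]] := @won_realizes k m d A; last by exists h.
move=> i.
have : type_at i d \in finset (fun th => `[< exists i, type_at i d = th >]).
  by rewrite finset.inE; apply/asboolP; exists i.
rewrite -Et finset.inE => /asboolP[j E].
exact: type_at_won E (realizes_won cA j).
Qed.

Theorem limit_omega_categorical : omega_categorical limit.
Proof.
move=> k _.
pose inv (t : k.-tuple nat) := invariant (tnth t).
(* Definable relations are unions of classes of the invariant, which takes values in a finite
   type. *)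
pose F (s : {set ({set game_types kappa B n k Q} * {set 'I_k * 'I_k})%type}) : set (k.-tuple nat) :=
  fun t => inv t \in s.
apply: (@sub_finite_set _ _ (F @` setT)%classic); last first.
  by apply: finite_image; apply: finite_finset.
move=> _ [phi _ <-].
exists (finset (fun c => `[< exists2 t, inv t = c & defined_relation limit phi t >])) => //.
apply/funext => t; apply/propext; rewrite /F finset.inE; split=> [/asboolP[s /invariant_same_type st]|h].
  exact: same_type_sat st.
by apply/asboolP; exists t.
Qed.

(** A finite image in the limit lies in some stage. Conversely, a won structure is requested along
    the empty tuple and can join every stage by closure under disjoint unions. *)
Theorem limit_CSP (Y : finType) (A : structure sigma Y) : CSP limit A <-> won A.
Proof.
split=> [[h /limit_hom_fin[j hj]]|wA]; first exact: won_hom hj (stage_won j).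
pose e : 'I_0 + 'I_#|Y| -> Y := join (@no_vars Y) enum_val.
pose A' : structure sigma ('I_0 + 'I_#|Y|) := fun R t => A R (map_tuple e t).
have wA' : won A' by apply: won_hom wA; instantiate (1 := e).
have [|h [_ _ hA]] := @won_realizes 0 #|Y| (@no_vars nat) A'.
  move=> i; rewrite /won join_unlabelled.
  exact: wins_disjoint (stage_won i) wA'.
exists (h \o enum_rank) => R t At.
have /hA : A' R (map_tuple (inr \o enum_rank) t).
  move: At; rewrite /A'; congr (A _ _).
  by apply: eq_from_tnth => j; rewrite !tnth_map /= enum_rankK.
by congr (limit _ _); apply: eq_from_tnth => j; rewrite !tnth_map.
Qed.

End Limit.

Arguments limit [kappa B] KB Q R t.

(** * The game as an MSO sentence *)

Lemma in_enumT (I : finType) (x : I) : x \in enum I.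
Proof. by rewrite mem_enum. Qed.

Section Formulas.

Variables (sigma : signature) (m : nat).

Definition fors k (s : seq (fo sigma m k)) : fo sigma m k :=
  foldr (@FOr sigma m k) (FAtom m (AFalse sigma k)) s.

Definition fands k (s : seq (fo sigma m k)) : fo sigma m k :=
  foldr (@FAnd sigma m k) (FNot (FAtom m (AFalse sigma k))) s.

Fixpoint exists_closure k : fo sigma m k -> fo sigma m 0 :=
  match k with
  | 0 => id
  | k'.+1 => fun p => exists_closure (FEx p)
  end.

Variables (T : Type) (S : structure sigma T) (V : 'I_m -> set T).

Lemma sat_fors k (I : eqType) (s : seq I) (f : I -> fo sigma m k) e :
  sat_fo S V e (fors [seq f x | x <- s]) <-> exists2 x, x \in s & sat_fo S V e (f x).
Proof.
elim: s => [|x s IH] /=; first by split=> // -[].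
split=> [[h|/IH[y ys h]]|[y]]; first by exists x; rewrite ?mem_head.
  by exists y => //; rewrite in_cons ys orbT.
by rewrite in_cons => /predU1P[->|ys] h; [left|right; apply/IH; exists y].
Qed.

Lemma sat_fands k (I : eqType) (s : seq I) (f : I -> fo sigma m k) e :
  sat_fo S V e (fands [seq f x | x <- s]) <-> forall x, x \in s -> sat_fo S V e (f x).
Proof.
elim: s => [|x s IH] /=; first by split=> // _ [].
split=> [[h /IH hs] y|h]; first by rewrite in_cons => /predU1P[->//|]; apply: hs.
split; first by apply: h; rewrite mem_head.
by apply/IH => y ys; apply: h; rewrite in_cons ys orbT.
Qed.

Lemma sat_exists_closure k (p : fo sigma m k) (e0 : 'I_0 -> T) :
  sat_fo S V e0 (exists_closure p) <-> exists e, sat_fo S V e p.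
Proof.
elim: k p => [|k IH] p /=.
  split=> [h|[e]]; first by exists e0.
  by have -> : e = e0 by apply/funext => -[].
rewrite IH /=; split=> [[e [a h]]|[e h]]; first by exists (extend e a).
exists (fun j => e (lift ord_max j)), (e ord_max).
have -> // : extend (fun j => e (lift ord_max j)) (e ord_max) = e.
apply/funext => j; rewrite /extend.
by case: unliftP => [j'|] ->.
Qed.

End Formulas.

Section Sentence.

Variables (kappa : signature) (B : finType) (KB : structure kappa B).
Arguments KB : clear implicits.
Variable Q : seq quant.

Notation n := (size Q).
Notation sigma := (game_sig kappa n).

Section Guards.

Variable m : nat.

(** [X] names the set variable of each value; where it is [None], the label is read as not
    containing the value. *)
Definition label_formula k (X : B -> option 'I_m) (b : B) (x : 'I_k) : fo sigma m k :=
  if X b is Some Z then FMem sigma Z x else FAtom m (AFalse _ _).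

Definition edge_formula k (x y : 'I_k) : fo sigma m k :=
  FAtom m (@ARel sigma _ (distinct_sym kappa n) [tuple x; y]).

Definition legal_formula (X : B -> option 'I_m) : fo sigma m 0 :=
  FAll (FAll (fands [seq
    FOr (FNot (FAnd (label_formula X p.1 (lift ord_max ord_max : 'I_2))
                    (label_formula X p.2 (ord_max : 'I_2))))
        (FOr (edge_formula (lift ord_max ord_max : 'I_2) ord_max)
             (edge_formula ord_max (lift ord_max ord_max : 'I_2)))
    | p <- enum [pred p : B * B | p.1 != p.2]])).

Definition labelled_formula (X : B -> option 'I_m) : fo sigma m 0 :=
  FAll (fors [seq label_formula X b (ord_max : 'I_1) | b <- enum B]).

Definition value_formula k (X : nat -> B -> option 'I_m) (b : B) (x : 'I_k) :
    fo sigma m k :=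
  fors [seq FAnd (FAtom m (@ARel sigma _ (block_sym kappa i) [tuple x]))
                 (label_formula (X i) b x) | i : 'I_n <- enum 'I_n].

(** The template enters only through its forbidden value tuples, which are finitely many as [B] is
    finite; the quantified variables are the coordinates of the constraint. *)
Definition violation_formula (X : nat -> B -> option 'I_m) : fo sigma m 0 :=
  fors [seq exists_closure (fors [seq
      FAnd (FAtom m (@ARel sigma _ (constr n c) (ord_tuple (arity c))))
           (fands [seq value_formula X (tnth v j) j | j <- enum 'I_(arity c)])
      | v : (arity c).-tuple B <- enum [pred v : (arity c).-tuple B | ~~ `[< KB c v >]]])
    | c <- enum kappa].

(** The set quantifiers of a prenex sentence range over all moves, so admissibility becomes a
    conjunct of the matrix for existential blocks and a premise for universal ones, nested in the
    order of play. *)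
Fixpoint guards (Qs : seq quant) (i : nat) (X : nat -> B -> option 'I_m) : fo sigma m 0 :=
  match Qs with
  | [::] => FNot (violation_formula X)
  | QEx :: Qs' => FAnd (labelled_formula (X i)) (guards Qs' i.+1 X)
  | QAll :: Qs' => FOr (FNot (legal_formula (X i))) (guards Qs' i.+1 X)
  end.

Variables (T : Type) (S : structure sigma T) (V : 'I_m -> set T).
Arguments S : clear implicits.

Definition labels_of (X : nat -> B -> option 'I_m) : labelling B T :=
  fun x i => finset (fun b => if X i b is Some Z then `[< V Z x >] else false).

Lemma sat_label X i k (e : 'I_k -> T) b z :
  sat_fo S V e (label_formula (X i) b z) <-> b \in labels_of X (e z) i.
Proof.
by rewrite finset.inE /label_formula; case: (X i b) => //= Z; split=> /asboolP.
Qed.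

Lemma sat_edge k (e : 'I_k -> T) x y :
  sat_fo S V e (edge_formula x y) <-> S (distinct_sym kappa n) [tuple e x; e y].
Proof.
by rewrite /=; have -> : map_tuple e [tuple x; y] = [tuple e x; e y] by apply: val_inj.
Qed.

Lemma sat_legal X i e :
  sat_fo S V e (legal_formula (X i)) <-> legal S (fun x => labels_of X x i).
Proof.
split=> [h x y b b' bx by' nb|h x y].
  have /sat_fands/(_ (b, b')) := h x y.
  rewrite mem_enum => /(_ nb) [[]|].
    by split; apply/sat_label; rewrite ?extend_lift extend_max.
  by case=> /sat_edge; rewrite !extend_lift !extend_max; [left|right].
apply/sat_fands => -[b b']; rewrite mem_enum => nb.
have [[hx hy]|nh] := pselect (b \in labels_of X x i /\ b' \in labels_of X y i); [right|left].
  by case: (h _ _ _ _ hx hy nb) => ?; [left|right]; apply/sat_edge;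
    rewrite !extend_lift !extend_max.
by case=> /sat_label hx /sat_label hy; apply: nh; move: hx hy;
  rewrite !extend_lift !extend_max.
Qed.

Lemma sat_labelled X i e :
  sat_fo S V e (labelled_formula (X i)) <-> forall x, labels_of X x i != finset.set0.
Proof.
split=> h x.
  have /sat_fors[b _ /sat_label] := h x; rewrite extend_max => bx.
  by apply/set0Pn; exists b.
apply/sat_fors; have /set0Pn[b bx] := h x; exists b; first exact: in_enumT.
by apply/sat_label; rewrite extend_max.
Qed.

Lemma sat_value k X b (x : 'I_k) e :
  sat_fo S V e (value_formula X b x) <-> has_value S (labels_of X) (e x) b.
Proof.
have et i : map_tuple e [tuple x] = [tuple e x] :> (arity (block_sym kappa i : sigma)).-tuple T.
  by apply: val_inj.
rewrite sat_fors; split=> [[i _ [Pi /sat_label bi]]|[i Pi bi]]; exists i => //.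
- by move: Pi; rewrite /= et.
- exact: in_enumT.
by split; [rewrite /= et|apply/sat_label].
Qed.

Lemma sat_violation X e :
  sat_fo S V e (violation_formula X) <-> violated KB S (labels_of X).
Proof.
rewrite sat_fors; split=> [[c _]|[c [t [v [St nK tv]]]]].
  rewrite sat_exists_closure => -[f /sat_fors[v]].
  rewrite mem_enum => /asboolP nK /= [Sf /sat_fands h].
  exists c, [tuple f j | j < arity c], v; split=> // j.
  by rewrite tnth_mktuple; apply/sat_value; apply: h; rewrite mem_enum.
exists c; first exact: in_enumT.
rewrite sat_exists_closure; exists (tnth t); apply/sat_fors; exists v.
  by rewrite mem_enum; apply/asboolP.
split=> /=.
  by move: St; congr (S _ _); apply: eq_from_tnth => j; rewrite !tnth_map tnth_ord_tuple.
by apply/sat_fands => j _; apply/sat_value.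
Qed.

End Guards.

(** Each block binds one set variable per value of [B]; variables bound earlier are renamed by
    [lshift]. *)
Fixpoint sentence_from (Qs : seq quant) (i m : nat) (X : nat -> B -> option 'I_m) :
    prenex (fun m => fo sigma m 0) m Qs :=
  match Qs with
  | [::] => Matrix (F := fun m => fo sigma m 0) (guards Q 0 X)
  | q :: Qs' =>
      Block q (sentence_from Qs' i.+1 (fun j b =>
        if j == i then Some (rshift m (enum_rank b))
        else omap (lshift #|B|) (X j b)))
  end.

Definition game_sentence : mso_sentence sigma Q := sentence_from Q 0 (fun _ _ => None).

(** * Prenex form of the game *)

Variables (T : Type) (S : structure sigma T).

Fixpoint guarded (Qs : seq quant) (i : nat) (H : labelling B T) : Prop :=
  match Qs with
  | [::] => ~ violated KB S H
  | QEx :: Qs' => (forall x, H x i != finset.set0) /\ guarded Qs' i.+1 H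
  | QAll :: Qs' => legal S (fun x => H x i) -> guarded Qs' i.+1 H
  end.

Fixpoint play (Qs : seq quant) (i : nat) (H : labelling B T)
    (P : labelling B T -> Prop) : Prop :=
  match Qs with
  | [::] => P H
  | QEx :: Qs' => exists w, play Qs' i.+1 (relabel H i w) P
  | QAll :: Qs' => forall w, play Qs' i.+1 (relabel H i w) P
  end.

(** Later moves leave the labels of earlier blocks untouched, so winning conditions need only agree
    on labellings that extend [H]. *)
Lemma play_ext Qs : forall i H (P P' : labelling B T -> Prop),
  (forall H', (forall x j, j < i -> H' x j = H x j) -> P H' <-> P' H') ->
  play Qs i H P <-> play Qs i H P'.
Proof.
elim: Qs => [|q Qs IH] i H P P' hP /=; first exact: hP.
have step w : play Qs i.+1 (relabel H i w) P <-> play Qs i.+1 (relabel H i w) P'.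
  apply: IH => H' hH; apply: hP => x j ji.
  by rewrite hH /relabel ?ltn_eqF // ltnW.
case: q; first by split=> -[w /step h]; exists w.
by split=> h w; apply/step.
Qed.

Lemma play_and Qs c P : forall i H,
  play Qs i H (fun H' => c /\ P H') <-> c /\ play Qs i H P.
Proof.
elim: Qs => [|[] Qs IH] i H //=.
- split=> [[w /IH[hc hw]]|[hc [w hw]]]; first by split=> //; exists w.
  by exists w; apply/IH.
- split=> [h|[hc h] w]; last by apply/IH.
  split=> [|w]; last by have /IH[] := h w.
  (* Some move must be made to extract [c]; the empty one serves. *)
  by have /IH[] := h (fun _ => finset.set0).
Qed.

Lemma play_imp Qs (c : Prop) P : forall i H,
  play Qs i H (fun H' => c -> P H') <-> (c -> play Qs i H P).
Proof.
elim: Qs => [|[] Qs IH] i H //=.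
- split=> [[w /IH h] hc|h]; first by exists w; apply: h.
  have [/h[w hw]|nc] := pselect c; first by exists w; apply/IH.
  by exists (fun _ => finset.set0); apply/IH.
- by split=> [h hc w|h w]; [move: hc; apply/IH|apply/IH => hc; apply: h].
Qed.

(** The guard of block [i] concerns only the move made there, so it commutes with all later
    quantifiers. *)
Lemma wins_play Qs : forall i H, wins KB S Qs i H <-> play Qs i H (guarded Qs i).
Proof.
elim: Qs => [|q Qs IH] i H //=.
have at_i w H' : (forall x j, j < i.+1 -> H' x j = relabel H i w x j) ->
    (fun x => H' x i) = w.
  by move=> h; apply/funext => x; rewrite h // /relabel eqxx.
case: q => /=; split.
- move=> [w [w0 /IH h]]; exists w.
  apply/(@play_ext _ _ _ _ (fun H' => (forall x, w x != finset.set0) /\ guarded Qs i.+1 H')).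
    by move=> H' /at_i <-.
  by apply/play_and.
- move=> [w h]; exists w.
  suff: play Qs i.+1 (relabel H i w)
      (fun H' => (forall x, w x != finset.set0) /\ guarded Qs i.+1 H').
    by move=> /play_and[w0 h']; split=> //; apply/IH.
  apply/play_ext; last exact: h.
  by move=> H' /at_i <-.
- move=> h w.
  apply/(@play_ext _ _ _ _ (fun H' => legal S w -> guarded Qs i.+1 H')).
    by move=> H' /at_i <-.
  by apply/play_imp => /h /IH.
- move=> h w lw; apply/IH.
  suff: play Qs i.+1 (relabel H i w) (fun H' => legal S w -> guarded Qs i.+1 H').
    by move=> /play_imp; apply.
  apply/play_ext; last exact: (h w).
  by move=> H' /at_i <-.
Qed.

Lemma sat_guards m (V : 'I_m -> set T) Qs : forall i X e,
  sat_fo S V e (guards Qs i X) <-> guarded Qs i (labels_of V X).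
Proof.
elim: Qs => [|[] Qs IH] i X e.
- by split=> h /sat_violation /h.
- by split=> -[h1 h2]; split; [move/sat_labelled: h1|move/IH: h2|apply/sat_labelled|apply/IH].
- split=> [[h /sat_legal/h//|/IH h _ //]|h].
  have [/h/IH|nl] := pselect (legal S (fun x => labels_of V X x i)); [by right|left].
  by move=> /sat_legal.
Qed.

Lemma labels_of_block m (V : 'I_m -> set T) (v : 'I_#|B| -> set T) X i :
  labels_of (extend_block V v) (fun j b =>
        if j == i then Some (rshift m (enum_rank b)) else omap (lshift #|B|) (X j b))
  = relabel (labels_of V X) i (fun x => finset (fun b => `[< v (enum_rank b) x >])).
Proof.
have vl Z : extend_block V v (lshift #|B| Z) = V Z.
  by rewrite /extend_block (unsplitK (inl Z)).
have vr Z : extend_block V v (rshift m Z) = v Z.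
  by rewrite /extend_block (unsplitK (inr Z)).
apply/funext => x; apply/funext => j; rewrite /relabel; apply/setP => b.
case: ifP => ji; rewrite !finset.inE ?ji ?vr //.
by case: (X j b) => //= Z; rewrite vl.
Qed.

(** A family of [#|B|] subsets of [T] amounts to a map from [T] to sets of values, so both
    quantifiers range over the same moves. *)
Lemma sat_sentence_from Qs : forall i m (V : 'I_m -> set T) X,
  sat_prenex (fun m (V : 'I_m -> set T) => sat_fo S V (@no_vars T)) V (sentence_from Qs i X)
  <-> play Qs i (labels_of V X) (guarded Q 0).
Proof.
have onto (w : T -> {set B}) : exists v : 'I_#|B| -> set T,
    (fun x => finset (fun b => `[< v (enum_rank b) x >])) = w.
  exists (fun r x => enum_val r \in w x).
  by apply/funext => x; apply/setP => b; rewrite finset.inE asboolb enum_rankK.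
elim: Qs => [|[] Qs IH] i m V X /=; first exact: sat_guards.
- split=> [[v /IH]|[w]]; rewrite ?labels_of_block.
    by move=> h; eexists; exact: h.
  by have [v <-] := onto w; rewrite -labels_of_block => /IH; exists v.
- split=> h.
    by move=> w; have [v <-] := onto w; rewrite -labels_of_block; apply/IH.
  by move=> v; apply/IH; rewrite labels_of_block.
Qed.

Theorem game_sentence_won : won KB S <-> mso_holds S game_sentence.
Proof.
rewrite /won /mso_holds /game_sentence sat_sentence_from wins_play.
have -> // : labels_of (@no_vars (set T)) (fun _ _ => None) = @unlabelled B T.
by apply/funext => x; apply/funext => j; apply/setP => b; rewrite !finset.inE.
Qed.

End Sentence.

(** * Instances *)

Section Instance.

Variables (tau : signature) (B : finType) (SB : structure tau B) (b0 : B).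
Variable Q : seq quant.

Notation n := (size Q).

(* [None] stands for falsity and [Some None] for equality, so that the rank of a
   symbol is the number starting the code of an atom. *)
Definition atom_sig : signature :=
  @Signature (option (option tau) : finType) (fun c =>
    match c with None => 0 | Some None => 2 | Some (Some R) => arity R end).

Definition atom_structure : structure atom_sig B :=
  fun c => match c return (@arity atom_sig c).-tuple B -> Prop with
  | None => fun _ => False
  | Some None => fun t => tnth t ord0 = tnth t (lift ord0 ord0)
  | Some (Some R) => fun t => SB t
  end.

Notation sigma := (game_sig atom_sig n).
Notation qpp := (fun m => seq (atom tau m)).

Fixpoint num_vars m Qs (phi : prenex qpp m Qs) : nat :=
  match phi with
  | Matrix _ => m
  | Block _ _ _ p => num_vars p
  end.

Fixpoint block_sizes m Qs (phi : prenex qpp m Qs) : seq nat :=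
  match phi with
  | Matrix _ => [::]
  | Block _ _ k p => k :: block_sizes p
  end.

Fixpoint matrix_atoms m Qs (phi : prenex qpp m Qs) : seq (atom tau (num_vars phi)) :=
  match phi return seq (atom tau (num_vars phi)) with
  | Matrix s => s
  | Block _ _ _ p => matrix_atoms p
  end.

Fixpoint block_indices (i : nat) (ks : seq nat) : seq nat :=
  if ks is k :: ks' then nseq k i ++ block_indices i.+1 ks' else [::].

Lemma num_varsE m Qs (phi : prenex qpp m Qs) : num_vars phi = m + sumn (block_sizes phi).
Proof. by elim: phi => {m Qs} [m s|m q Qs k p /= ->] /=; rewrite ?addn0 ?addnA. Qed.

Lemma size_block_sizes m Qs (phi : prenex qpp m Qs) : size (block_sizes phi) = size Qs.
Proof. by elim: phi => {m Qs} //= m q Qs k p ->. Qed.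

(** * Facts of an instance *)

Section Facts.

Variable N : nat.

Definition atom_fact (a : atom tau N) : fact sigma N :=
  match a with
  | AFalse => @existT sigma _ (@constr atom_sig n None) [tuple]
  | AEq x y => @existT sigma _ (@constr atom_sig n (Some None)) [tuple x; y]
  | ARel R t => @existT sigma _ (@constr atom_sig n (Some (Some R))) t
  end.

Definition block_fact (i : 'I_n) (v : 'I_N) : fact sigma N :=
  @existT sigma _ (block_sym atom_sig i) [tuple v].

Definition edge_fact (u v : 'I_N) : fact sigma N :=
  @existT sigma _ (distinct_sym atom_sig n) [tuple u; v].

(** Variables and smaller endpoints run downwards because the machine produces them by decrementing
    counters. *)
Definition extra_facts (blk : nat -> 'I_n) : seq (fact sigma N) :=
  flatten [seq block_fact (blk v) v :: [seq edge_fact u v | u : 'I_N <- rev (enum 'I_N) & u < v]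
    | v : 'I_N <- rev (enum 'I_N)].

Definition facts_structure (l : seq (fact sigma N)) : structure sigma 'I_N :=
  fun R t => Tagged (fun R : sigma => (arity R).-tuple 'I_N) t \in l.

Definition fact_holds (e : 'I_N -> B) (f : fact sigma N) : Prop :=
  let: existT R t := f in
  match R return (@arity sigma R).-tuple 'I_N -> Prop with
  | inl c => fun t => atom_structure (map_tuple e t)
  | inr _ => fun _ => True
  end t.

Lemma atom_fact_holds e a : sat_atom SB e a <-> fact_holds e (atom_fact a).
Proof. by case: a => [|x y|R t] /=; rewrite ?tnth_map. Qed.

Definition is_atom_fact (f : fact sigma N) : bool := if tag f is inl _ then true else false.

Lemma atom_facts_hold e (s : seq (atom tau N)) :
  (forall i : 'I_(size s), sat_atom SB e (tnth (in_tuple s) i)) <->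
  forall f, f \in map atom_fact s -> fact_holds e f.
Proof.
have nthE (i : 'I_(size s)) : atom_fact (tnth (in_tuple s) i) =
    nth (atom_fact (AFalse _ _)) (map atom_fact s) i.
  by rewrite (nth_map (AFalse _ _)) // (tnth_nth (AFalse _ _)).
split=> [h f|h i].
  move=> /(nthP (atom_fact (AFalse _ _)))[i]; rewrite size_map => ilt <-.
  by have := h (Ordinal ilt) => /atom_fact_holds; rewrite nthE.
by apply/atom_fact_holds/h; rewrite nthE mem_nth // size_map.
Qed.

Lemma tagged_inj (R : sigma) (t t' : (arity R).-tuple 'I_N) :
  (@existT sigma (fun R => (arity R).-tuple 'I_N) R t == existT _ R t') = (t == t').
Proof. by rewrite -tag_eqE /tag_eq eqxx tagged_asE. Qed.

Lemma atom_fact_extra blk f : is_atom_fact f -> f \notin extra_facts blk.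
Proof.
move=> af; apply/negP => /flattenP[_ /mapP[v _ ->]].
rewrite in_cons => /predU1P[E|/mapP[u _ E]]; by rewrite E in af.
Qed.

Lemma is_atom_atom_facts s f : f \in map atom_fact s -> is_atom_fact f.
Proof.
elim: s => //= a s IH; rewrite in_cons => /predU1P[->|//].
by case: a.
Qed.

Lemma mem_block_fact blk i v : (block_fact i v \in extra_facts blk) = (i == blk v).
Proof.
apply/flattenP/idP => [[_ /mapP[u _ ->]]|/eqP ->].
  rewrite in_cons => /predU1P[E|/mapP[w _ E]].
    have ei : i = blk u by have := congr1 (@tag _ _) E => -[].
    by move/eqP: E; rewrite ei tagged_inj -val_eqE /= => /andP[/eqP ->].
  by have := congr1 (@tag _ _) E.
exists (block_fact (blk v) v :: [seq edge_fact u v | u : 'I_N <- rev (enum 'I_N) & u < v]).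
  by apply/mapP; exists v => //; rewrite mem_rev mem_enum.
by rewrite mem_head.
Qed.

Lemma mem_edge_fact blk u v : (edge_fact u v \in extra_facts blk) = (u < v).
Proof.
apply/flattenP/idP => [[_ /mapP[w _ ->]]|uv].
  rewrite in_cons => /predU1P[E|/mapP[w']].
    by have := congr1 (@tag _ _) E.
  rewrite mem_filter => /andP[lt _] /eqP.
  by rewrite tagged_inj -val_eqE /= => /andP[/eqP -> /andP[/eqP -> _]].
exists (block_fact (blk v) v :: [seq edge_fact u v | u : 'I_N <- rev (enum 'I_N) & u < v]).
  by apply/mapP; exists v => //; rewrite mem_rev mem_enum.
rewrite in_cons; apply/orP; right.
by apply: map_f; rewrite mem_filter uv mem_rev mem_enum.
Qed.

End Facts.

Fixpoint blocks_agree (blk : nat -> 'I_n) (i m : nat) Qs (phi : prenex qpp m Qs) : Prop :=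
  match phi with
  | Matrix _ => True
  | Block _ _ k p =>
      (forall v, m <= v < m + k -> blk v = i :> nat) /\ blocks_agree blk i.+1 p
  end.

Definition position (m k v : nat) : option 'I_k := if m <= v then insub (v - m) else None.

Lemma positionE m k (j : 'I_k) : position m k (m + j) = Some j.
Proof.
rewrite /position leq_addr addKn insubT // => lt.
by congr Some; apply: val_inj.
Qed.

Lemma extend_block_split T m k (e : 'I_m -> T) (f : 'I_k -> T) (P : 'I_(m + k) -> T -> Prop) :
  (forall j, P (lshift k j) (e j)) -> (forall j, P (rshift m j) (f j)) ->
  forall j, P j (extend_block e f j).
Proof.
move=> hl hr j; rewrite /extend_block -[j in P j]splitK.
by case: split.
Qed.

Variable blk : nat -> 'I_n.

Definition instance_structure m Qs (phi : prenex qpp m Qs) : structure sigma 'I_(num_vars phi) :=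
  facts_structure (map (@atom_fact _) (matrix_atoms phi) ++ extra_facts _ blk).
Arguments instance_structure [m Qs] phi R t.

Lemma in_block_instance m Qs (phi : prenex qpp m Qs) i v :
  in_block (instance_structure phi) i v <-> i = blk v.
Proof.
rewrite /in_block /instance_structure /facts_structure mem_cat.
rewrite (_ : (_ \in map _ _) = false) /=; last first.
  by apply/negP => /is_atom_atom_facts.
by rewrite mem_block_fact; split=> /eqP.
Qed.

Lemma apart_instance m Qs (phi : prenex qpp m Qs) u v :
  apart (instance_structure phi) u v <-> u != v.
Proof.
have edge x y : instance_structure phi (distinct_sym atom_sig n) [tuple x; y] <-> x < y.
  rewrite /instance_structure /facts_structure mem_cat.
  rewrite (_ : (_ \in map _ _) = false) /=; last by apply/negP => /is_atom_atom_facts.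
  by rewrite mem_edge_fact.
rewrite /apart neq_ltn; split=> [[]/edge ->|/orP[]/edge]; rewrite ?orbT //.
  by left.
by right.
Qed.

Lemma constr_instance m Qs (phi : prenex qpp m Qs) c t :
  instance_structure phi (constr n c) t <->
  @existT sigma _ (constr n c) t \in map (@atom_fact _) (matrix_atoms phi).
Proof.
rewrite /instance_structure /facts_structure mem_cat.
by rewrite (negPf (@atom_fact_extra _ _ (existT _ (constr n c) t) _)) ?orbF.
Qed.

(** Strategies for the sentence carry over under the invariant that the label of a quantified
    variable, in its own block, contains at most its value. *)
Lemma blocks_agree_wins m Qs (phi : prenex qpp m Qs) (S : structure sigma 'I_(num_vars phi)) :
  forall i (e : 'I_m -> B) (H : labelling B 'I_(num_vars phi)),
  (forall u v, apart S u v <-> u != v) ->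
  (forall i v, in_block S i v <-> i = blk v) ->
  (forall c t, S (constr n c) t <->
     @existT sigma _ (constr n c) t \in map (@atom_fact _) (matrix_atoms phi)) ->
  blocks_agree blk i phi ->
  (forall v, v < m -> blk v < i) ->
  (forall (j : 'I_m) (v : 'I_(num_vars phi)) b, v = j :> nat -> b \in H v (blk v) -> b = e j) ->
  sat_prenex (fun m e (s : seq (atom tau m)) =>
                forall i : 'I_(size s), sat_atom SB e (tnth (in_tuple s) i)) e phi ->
  wins atom_structure S Qs i H.
Proof.
elim: phi S => {m Qs} [m s|m q Qs k p IH] /= S i e H Sapart Sblock Sconstr agree lt_i He.
  move=> /atom_facts_hold hs [c [t [v [/Sconstr /hs /= Ht nv tv]]]]; apply: nv.
  move: Ht; congr atom_structure; apply: eq_from_tnth => j; rewrite tnth_map.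
  by have [i' /Sblock -> /(He (tnth t j) _ _ erefl) ->] := tv j.
case: agree => agree_i agree.
have step (w : 'I_(num_vars p) -> {set B}) (f : 'I_k -> B) :
    (forall (j : 'I_k) (v : 'I_(num_vars p)) b, v = m + j :> nat -> b \in w v -> b = f j) ->
    sat_prenex (fun m e (s : seq (atom tau m)) =>
      forall i : 'I_(size s), sat_atom SB e (tnth (in_tuple s) i)) (extend_block e f) p ->
    wins atom_structure S Qs i.+1 (relabel H i w).
  move=> wf; apply: IH => //.
    move=> v vlt; have [/lt_i/ltnW //|mv] := ltnP v m.
    by rewrite agree_i // mv.
  apply: (@extend_block_split _ _ _ e f (fun j y => forall (v : 'I_(num_vars p)) b,
    v = j :> nat -> b \in relabel H i w v (blk v) -> b = y)) => j v b vj.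
    by rewrite /relabel ltn_eqF; [apply: He|rewrite lt_i // vj /=].
  have Ei : blk v = i :> nat by apply: agree_i; rewrite vj leq_addr ltn_add2l /=.
  by rewrite /relabel Ei eqxx; apply: wf.
case: q => /=.
- move=> [f hf].
  (* Labels outside the current block are never read but must be nonempty, so they consist of all
     values. *)
  exists (fun v => if position m k v is Some j then [set f j]%SET else finset.setT); split.
    move=> v; apply/set0Pn; case: position => [j|]; last by exists b0; rewrite finset.inE.
    by exists (f j); rewrite finset.inE.
  by apply: step hf => j v b ->; rewrite positionE finset.inE => /eqP.
- move=> hall w lw.
  (* A legal label has at most one value, as no variable is apart from itself; for an empty label
     [b0] stands in. *)
  pose f (j : 'I_k) : B := odflt b0 [pick b | [exists v : 'I_(num_vars p), (v == m + j :> nat) && (b \in w v)]].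
  apply: (step _ f) => // j v b vj bw; rewrite /f.
  case: pickP => [b' /existsP[v' /andP[/eqP vj' bw']]|/(_ b)/existsP[]]; last first.
    by exists v; rewrite vj eqxx.
  have {vj'} ev : v' = v by apply: val_inj; rewrite /= vj' vj.
  subst v'; apply/eqP; apply: contraT => nb.
  by have /Sapart := lw _ _ _ _ bw bw' nb; rewrite eqxx.
Qed.

(** The invariant is now the opposite inclusion: labels contain the values, so a false atom yields a
    violated constraint. Existential values are picked from the nonempty labels. *)
Lemma wins_blocks_agree m Qs (phi : prenex qpp m Qs) (S : structure sigma 'I_(num_vars phi)) :
  forall i (e : 'I_m -> B) (H : labelling B 'I_(num_vars phi)),
  (forall u v, apart S u v <-> u != v) ->
  (forall i v, in_block S i v <-> i = blk v) ->
  (forall c t, S (constr n c) t <->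
     @existT sigma _ (constr n c) t \in map (@atom_fact _) (matrix_atoms phi)) ->
  blocks_agree blk i phi ->
  (forall v, v < m -> blk v < i) ->
  (forall (j : 'I_m) (v : 'I_(num_vars phi)), v = j :> nat -> e j \in H v (blk v)) ->
  wins atom_structure S Qs i H ->
  sat_prenex (fun m e (s : seq (atom tau m)) =>
                forall i : 'I_(size s), sat_atom SB e (tnth (in_tuple s) i)) e phi.
Proof.
elim: phi S => {m Qs} [m s|m q Qs k p IH] /= S i e H Sapart Sblock Sconstr agree lt_i He.
  move=> nv; apply/atom_facts_hold => f fs.
  have : is_atom_fact f by apply: is_atom_atom_facts fs.
  case: f fs => -[c|//] t fs _; apply: contrapT => nt; apply: nv.
  exists c, t, (map_tuple e t); split; [exact/Sconstr|exact: nt|].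
  by move=> j; exists (blk (tnth t j)); [apply/Sblock|rewrite tnth_map; apply: He].
case: agree => agree_i agree.
have step (w : 'I_(num_vars p) -> {set B}) (f : 'I_k -> B) :
    (forall (j : 'I_k) (v : 'I_(num_vars p)), v = m + j :> nat -> f j \in w v) ->
    wins atom_structure S Qs i.+1 (relabel H i w) ->
    sat_prenex (fun m e (s : seq (atom tau m)) =>
      forall i : 'I_(size s), sat_atom SB e (tnth (in_tuple s) i)) (extend_block e f) p.
  move=> wf; apply: IH => //.
    move=> v vlt; have [/lt_i/ltnW //|mv] := ltnP v m.
    by rewrite agree_i // mv.
  apply: (@extend_block_split _ _ _ e f (fun j y => forall (v : 'I_(num_vars p)),
    v = j :> nat -> y \in relabel H i w v (blk v))) => j v vj.
    by rewrite /relabel ltn_eqF; [apply: He|rewrite lt_i // vj /=].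
  have Ei : blk v = i :> nat by apply: agree_i; rewrite vj leq_addr ltn_add2l /=.
  by rewrite /relabel Ei eqxx; apply: wf.
have mk_lt (j : 'I_k) : m + j < num_vars p.
  by rewrite num_varsE -addnA ltn_add2l (leq_trans (ltn_ord j)) ?leq_addr.
case: q => /=.
- move=> [w [w0 hw]].
  have /choice[f fw] : forall j : 'I_k, exists b, b \in w (Ordinal (mk_lt j)).
    by move=> j; apply/set0Pn.
  exists f; apply: step hw => j v vj; have := fw j.
  by congr (_ \in w _); apply: val_inj.
- move=> hall f.
  (* Legal because labels have at most one element, so different values sit on distinct variables,
     and these are apart. *)
  pose w (v : 'I_(num_vars p)) : {set B} :=
    if position m k v is Some j then [set f j]%SET else finset.set0.
  apply: (step w); first by move=> j v vj; rewrite /w vj positionE finset.inE.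
  apply: hall => x y b b'; rewrite /w => bx by' nb; apply/Sapart.
  apply: contraNneq nb => e'; subst y; move: bx by'.
  by case: position => [j|]; rewrite ?finset.inE // => /eqP -> /eqP ->.
Qed.

Theorem instance_won (phi : qpp_sentence tau Q) :
  blocks_agree blk 0 phi ->
  won atom_structure (instance_structure phi) <-> QCSP SB phi.
Proof.
move=> agree; split.
- apply: wins_blocks_agree => //; try by case.
  + exact: apart_instance.
  + exact: in_block_instance.
  + exact: constr_instance.
- apply: blocks_agree_wins => //; try by case.
  + exact: apart_instance.
  + exact: in_block_instance.
  + exact: constr_instance.
Qed.

End Instance.


Arguments instance_structure [tau Q] blk [m Qs] phi R t.

(** * Structured programs for Turing machines *)

Section Programs.

Variables (W : finType) (K : nat).

Notation symbol := (option (bool + W)).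
Notation I := 'I_K.+1.
Notation tp := (tape (bool + W)).

Definition symbols : Type := I -> symbol.
Definition actions : Type := I -> symbol * move.
Definition tapes_state : Type := I -> tp.

Inductive program : Type :=
| Act of symbols -> actions
| Seq of program & program
| While of (symbols -> bool) & program.

Fixpoint control (c : program) : finType :=
  match c with
  | Act _ => unit
  | Seq c1 c2 => (control c1 + control c2)%type
  | While _ c => option (control c)
  end.

Fixpoint entry (c : program) : control c :=
  match c return control c with
  | Act _ => tt
  | Seq c1 c2 => inl (entry c1)
  | While _ c => None
  end.

Definition idle (s : symbols) : actions := fun k => (s k, MStay).

(* The next control point is [None] when the program terminates. *)
Fixpoint transition (c : program) : control c -> symbols -> option (control c) * actions :=
  match c return control c -> symbols -> option (control c) * actions with
  | Act f => fun _ s => (None, f s)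
  | Seq c1 c2 => fun q s =>
      match q with
      | inl q1 => let: (o, a) := transition q1 s in
          (Some (if o is Some q' then inl q' else inr (entry c2)), a)
      | inr q2 => let: (o, a) := transition q2 s in (omap inr o, a)
      end
  | While p c => fun q s =>
      match q with
      | None => (if p s then Some (Some (entry c)) else None, idle s)
      | Some q' => let: (o, a) := transition q' s in (Some o, a)
      end
  end.

Definition heads (ts : tapes_state) : symbols := fun k => under (ts k).
Definition write (ts : tapes_state) (a : actions) : tapes_state :=
  fun k => write_move (ts k) (a k).

Lemma write_idle ts : write ts (idle (heads ts)) = ts.
Proof. by apply/funext => k; rewrite /write /idle /heads; case: (ts k). Qed.

Definition pstep (c : program) (x : option (control c) * tapes_state) :=
  if x.1 is Some q then
    let: (o, a) := transition q (heads x.2) in (o, write x.2 a)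
  else x.

Lemma iter_pstep_done c t ts : iter t (@pstep c) (None, ts) = (None, ts).
Proof. by elim: t => //= t ->. Qed.

Lemma iter_pstep_some c (q : control c) t ts :
  iter t.+1 (@pstep c) (Some q, ts) = iter t (@pstep c)
    ((transition q (heads ts)).1, write ts (transition q (heads ts)).2).
Proof. by rewrite iterSr {2}/pstep /=; case: transition. Qed.

Definition terminates (c : program) (q : control c) (t : nat) (ts : tapes_state)
    (P : tapes_state -> Prop) : Prop :=
  exists2 ts', iter t (@pstep c) (Some q, ts) = (None, ts') & P ts'.

Definition finishes (c : program) (t : nat) (ts : tapes_state)
    (P : tapes_state -> Prop) : Prop := terminates (entry c) t ts P.

Lemma terminates_le c q t t' ts P : t <= t' -> @terminates c q t ts P -> terminates q t' ts P.
Proof.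
move=> tt' [ts' E Pts]; exists ts' => //.
by rewrite -(subnK tt') iterD E iter_pstep_done.
Qed.

Lemma finishes_le c t t' ts P : t <= t' -> finishes c t ts P -> finishes c t' ts P.
Proof. exact: terminates_le. Qed.

Lemma finishes_weaken c t ts (P P' : tapes_state -> Prop) :
  (forall ts, P ts -> P' ts) -> finishes c t ts P -> finishes c t ts P'.
Proof. by move=> h [ts' E /h Pts]; exists ts'. Qed.

Lemma finishes_act f ts (P : tapes_state -> Prop) :
  P (write ts (f (heads ts))) -> finishes (Act f) 1 ts P.
Proof. by move=> h; exists (write ts (f (heads ts))). Qed.

Lemma finishes_seq c1 c2 t1 t2 ts (P R : tapes_state -> Prop) :
  finishes c1 t1 ts P -> (forall ts', P ts' -> finishes c2 t2 ts' R) ->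
  finishes (Seq c1 c2) (t1 + t2) ts R.
Proof.
have second q t ts0 : @terminates c2 q t ts0 R ->
    @terminates (Seq c1 c2) (inr q) t ts0 R.
  elim: t q ts0 => [|t IH] q ts0 [ts' E Rts]; first by [].
  move: E; rewrite /terminates !iter_pstep_some /=.
  case: (transition q (heads ts0)) => -[q'|] a /= E; last first.
    rewrite iter_pstep_done in E; case: E => E.
    by exists (write ts0 a); [exact: (@iter_pstep_done (Seq c1 c2))|rewrite E].
  by apply: IH; exists ts'.
rewrite /finishes /=; move: (entry c1) => q; elim: t1 q ts => [|t1 IH] q ts [ts' E Pts] h.
  by [].
move: E; rewrite /terminates addSn !iter_pstep_some /=.
case: (transition q (heads ts)) => -[q'|] a /= E; last first.
  rewrite iter_pstep_done in E; case: E => E; subst ts'.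
  exact: (@terminates_le (Seq c1 c2) _ _ _ _ _ (leq_addl t1 t2) (second _ _ _ (h _ Pts))).
by apply: IH h; exists ts'.
Qed.

Lemma finishes_while_step (p : symbols -> bool) c t1 t2 ts (P R : tapes_state -> Prop) :
  p (heads ts) -> finishes c t1 ts P ->
  (forall ts', P ts' -> finishes (While p c) t2 ts' R) ->
  finishes (While p c) (t1 + t2).+1 ts R.
Proof.
move=> pts hc h; rewrite /finishes /terminates iter_pstep_some /= pts write_idle.
move: hc; rewrite /finishes; move: (entry c) => q {pts}.
elim: t1 q ts => [|t1 IH] q ts [ts' E Pts]; first by [].
move: E; rewrite addSn iter_pstep_some (@iter_pstep_some (While p c)) /=.
case: (transition q (heads ts)) => -[q'|] a /= E; last first.
  rewrite iter_pstep_done in E; case: E => E; subst ts'.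
  have [ts2 E2 R2] := h _ Pts; exists ts2 => //.
  rewrite iterD; exact: etrans (congr1 (iter t1 (@pstep (While p c))) E2) (@iter_pstep_done (While p c) _ _).
by apply: IH; exists ts'.
Qed.

(** [x] counts the iterations left; each costs one more step for the test, and so does leaving the
    loop. *)
Lemma finishes_while (p : symbols -> bool) c tb (Inv : nat -> tapes_state -> Prop) :
  (forall x ts, Inv x.+1 ts -> p (heads ts) /\ finishes c tb ts (Inv x)) ->
  (forall ts, Inv 0 ts -> ~~ p (heads ts)) ->
  forall x ts, Inv x ts -> finishes (While p c) (x * tb.+1).+1 ts (Inv 0).
Proof.
move=> hS h0; elim=> [|x IH] ts Its.
  exists ts => //; rewrite /= /pstep /= (negPf (h0 _ Its)).
  by rewrite write_idle.
have [pts hc] := hS _ _ Its.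
apply: (finishes_le (t := (tb + (x * tb.+1).+1).+1)).
  by rewrite mulSn addnS addSn.
exact: finishes_while_step pts hc IH.
Qed.

Definition machine (c : program) : tm :=
  @TM K W (option (control c)) (Some (entry c)) (fun q => ~~ isSome q)
    (fun q s =>
       let: (o, a) := if q is Some q' then transition q' (tnth s) else (None, idle (tnth s)) in
       (o, [tuple a k | k < K.+1])).

Definition tapes_tuple (ts : tapes_state) : (K.+1).-tuple tp := [tuple ts k | k < K.+1].

Lemma machine_step c q ts :
  @step (machine c) (q, tapes_tuple ts) =
  ((@pstep c (q, ts)).1, tapes_tuple (@pstep c (q, ts)).2).
Proof.
case: q => [q|] //; rewrite /step /pstep /=.
have -> : tnth (map_tuple (@under (bool + W)) (tapes_tuple ts)) = heads ts.
  by apply/funext => k; rewrite tnth_map tnth_mktuple.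
case: (transition q (heads ts)) => o a /=; congr pair.
by apply: eq_from_tnth => k; rewrite !tnth_mktuple.
Qed.

Definition input_state (w : word) : tapes_state :=
  fun k => if k == ord0 then input_tape W w else Tape [::] None [::].

Lemma machine_computes c w t w' :
  finishes c t (input_state w)
    (fun ts => leading_bits (under (ts ord0) :: after (ts ord0)) = w') ->
  computes_within (machine c) w t w'.
Proof.
move=> [ts E out].
have run t' x : iter t' (@step (machine c)) (x.1, tapes_tuple x.2) =
    ((iter t' (@pstep c) x).1, tapes_tuple (iter t' (@pstep c) x).2).
  elim: t' => //= t' ->; rewrite machine_step.
  by case: (iter t' _ x).
rewrite /computes_within (_ : init (machine c) w =
  ((Some (entry c), input_state w).1, tapes_tuple (Some (entry c), input_state w).2)) //.
by rewrite run E /= /output /= tnth_mktuple.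
Qed.

End Programs.

(** * Tape primitives and unary counters *)

Section Tapes.

Variables (W : finType) (K : nat).

Notation symbol := (option (bool + W)).
Notation tp := (tape (bool + W)).
Notation I := 'I_K.+1.
Notation tapes_state := (tapes_state W K).
Notation program := (program W K).

Definition bit (b : bool) : symbol := Some (inl b).
Notation one := (bit true).

Definition tape_at (l r : seq symbol) : tp := Tape l (head None r) (behead r).
Definition tape_before (l r : seq symbol) : tp := Tape (behead l) (head None l) r.

Definition blank (s : seq symbol) : bool := all (pred1 None) s.

Lemma blank_head s : blank s -> head None s = None.
Proof. by case: s => //= x s /andP[/eqP]. Qed.

Lemma blank_behead s : blank s -> blank (behead s).
Proof. by case: s => //= x s /andP[]. Qed.

Definition ends_with (l : seq symbol) (t : tp) : Prop :=
  exists2 r, blank r & t = tape_at l r.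

(** The head is on the blank after the ones; in [counter_last] it is on the last one, where erasing
    decrements. Blank cells may be listed, since erasing leaves them behind. *)
Definition counter (x : nat) (t : tp) : Prop :=
  exists2 z, blank z & ends_with (nseq x one ++ z) t.

Definition counter_last (x : nat) (t : tp) : Prop :=
  exists z r, [/\ blank z, blank r & t = tape_before (nseq x one ++ z) r].

Definition on_tape (i : I) (a : symbol -> symbol * move) (s : symbols W K) : actions W K :=
  fun k => if k == i then a (s k) else (s k, MStay).

Definition step_left (i : I) : program := Act (on_tape i (fun s => (s, MLeft))).
Definition step_right (i : I) : program := Act (on_tape i (fun s => (s, MRight))).
Definition erase (i : I) : program := Act (on_tape i (fun _ => (None, MStay))).
Definition put (i : I) (b : bool) : program := Act (on_tape i (fun _ => (bit b, MRight))).
Definition nonblank (i : I) (s : symbols W K) : bool := s i != None.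

Lemma write_on_tape ts i a :
  write ts (on_tape i a (heads ts)) i = write_move (ts i) (a (under (ts i))).
Proof. by rewrite /write /on_tape eqxx. Qed.

Lemma write_off_tape ts i a k : k != i -> write ts (on_tape i a (heads ts)) k = ts k.
Proof. by rewrite /write /on_tape => /negPf ->; rewrite /heads; case: (ts k). Qed.

Lemma counter_step_left x ts i : counter x (ts i) ->
  finishes (step_left i) 1 ts (fun ts' =>
    counter_last x (ts' i) /\ forall k, k != i -> ts' k = ts k).
Proof.
move=> [z bz [r br E]]; apply: finishes_act; split=> [|k ki]; last exact: write_off_tape.
rewrite write_on_tape E; exists z, (None :: behead r); split=> //.
  by rewrite /= blank_behead.
by rewrite /= (blank_head br).
Qed.

Lemma counter_last_erase x ts i : counter_last x.+1 (ts i) ->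
  finishes (erase i) 1 ts (fun ts' =>
    counter x (ts' i) /\ forall k, k != i -> ts' k = ts k).
Proof.
move=> [z [r [bz br E]]]; apply: finishes_act; split=> [|k ki]; last exact: write_off_tape.
by rewrite write_on_tape E; exists z => //; exists (None :: r).
Qed.

Lemma counter_last_head x ts i : counter_last x (ts i) -> nonblank i (heads ts) = (0 < x).
Proof. by move=> [z [r [bz br E]]]; rewrite /nonblank /heads E; case: x {E} => //=; rewrite blank_head. Qed.

Lemma counter_last0 t : counter_last 0 t -> counter 0 t.
Proof.
move=> [z [r [bz br ->]]]; exists (behead z); first exact: blank_behead.
by exists (None :: r) => //; rewrite /tape_before /tape_at /= (blank_head bz).
Qed.

Lemma ends_with_put l ts i b : ends_with l (ts i) ->
  finishes (put i b) 1 ts (fun ts' =>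
    ends_with (bit b :: l) (ts' i) /\ forall k, k != i -> ts' k = ts k).
Proof.
move=> [r br E]; apply: finishes_act; split=> [|k ki]; last exact: write_off_tape.
by rewrite write_on_tape E; exists (behead r) => //; apply: blank_behead.
Qed.

(* Appends the ones on tape [i] to tape [j]. *)
Definition transfer (i j : I) : program :=
  Seq (step_left i)
    (Seq (While (nonblank i) (Act (fun s k =>
            if k == j then (one, MRight) else if k == i then (s k, MLeft) else (s k, MStay))))
      (Seq (step_right i) (While (nonblank i) (step_right i)))).

Definition transfer_time (x : nat) : nat := 1 + ((x * 2).+1 + (1 + (x * 2).+1)).

Lemma finishes_transfer i j x l ts : i != j -> counter x (ts i) -> ends_with l (ts j) ->
  finishes (transfer i j) (transfer_time x) ts (fun ts' =>
    [/\ counter x (ts' i), ends_with (nseq x one ++ l) (ts' j)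
      & forall k, k != i -> k != j -> ts' k = ts k]).
Proof.
move=> ij ci ej.
apply: finishes_seq (counter_step_left ci) _ => ts1 [[z [r [bz br E1]]] f1].
pose Inv y (s : tapes_state) :=
  [/\ y <= x, s i = tape_before (nseq y one ++ z) (nseq (x - y) one ++ r),
      ends_with (nseq (x - y) one ++ l) (s j)
    & forall k, k != i -> k != j -> s k = ts k].
have I1 : Inv x ts1.
  split=> //; first by rewrite subnn.
    by rewrite subnn f1 // eq_sym.
  by move=> k ki kj; apply: f1.
apply: finishes_seq.
  apply: (finishes_while (tb := 1) (Inv := Inv)) I1.
    move=> y s [yx Ei [r' br' Ej] fr]; split.
      by rewrite /nonblank /heads Ei.
    apply: finishes_act; split; first exact: ltnW.
    - rewrite /write eqxx (negPf ij) /heads Ei /=.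
      by rewrite /tape_before -(subnSK yx).
    - rewrite /write eqxx Ej; exists (behead r'); first exact: blank_behead.
      by rewrite -(subnSK yx).
    - move=> k ki kj; rewrite /write (negPf ki) (negPf kj) -fr // /heads.
      by case: (s k).
  by move=> s [_ Ei _ _]; rewrite /nonblank /heads Ei /= blank_head.
move=> ts2 [_ E2 ej2 f2]; rewrite subn0 in E2 ej2.
(* The way back restores the head position, so that the counter can be read again. *)
pose Inv2 y (s : tapes_state) :=
  [/\ y <= x, s i = tape_at (nseq (x - y) one ++ None :: behead z) (nseq y one ++ r),
      ends_with (nseq x one ++ l) (s j)
    & forall k, k != i -> k != j -> s k = ts k].
apply: (finishes_seq (P := Inv2 x)).
  apply: finishes_act; split=> //.
  - by rewrite write_on_tape E2 /= subnn /= (blank_head bz).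
  - by rewrite write_off_tape // eq_sym.
  - by move=> k ki kj; rewrite write_off_tape // f2.
move=> ts3 I3.
apply: (finishes_weaken (P := Inv2 0)).
  move=> s [_ Ei Ej fr]; split=> //.
  exists (None :: behead z); first exact: blank_behead.
  by rewrite subn0 in Ei; exists r.
apply: (finishes_while (tb := 1) (Inv := Inv2)) I3 => [y s [yx Ei Ej fr]|s [_ Ei _ _]].
  split; first by rewrite /nonblank /heads Ei.
  apply: finishes_act; split; first exact: ltnW.
  - by rewrite write_on_tape Ei -(subnSK yx).
  - by rewrite write_off_tape // eq_sym.
  - by move=> k ki kj; rewrite write_off_tape // fr.
by rewrite /nonblank /heads Ei /= blank_head.
Qed.

Lemma leading_bits_blank w r : blank r ->
  leading_bits (map bit w ++ r) = w.
Proof.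
move=> br; elim: w => [|b w IH] /=; last by rewrite IH.
by case: r br => //= x r /andP[/eqP ->].
Qed.

Lemma leading_bits_at l r : leading_bits (under (tape_at l r) :: after (tape_at l r)) = leading_bits (W := W) r.
Proof. by case: r. Qed.

End Tapes.

(** * The reduction machine *)

Section Printer.

Variables (n : nat) (block_code : 'I_n -> nat) (code_bound edge_code : nat).
Hypothesis block_code_le : forall i, block_code i <= code_bound.

Notation W := ('I_n : finType).
Notation symbol := (option (bool + W)).
Notation tp := (tape (bool + W)).
Notation tapes_state := (tapes_state W 3).
Notation program := (program W 3).
Notation one := (bit W true).

Definition tape0 : 'I_4 := ord0.
Definition tape1 : 'I_4 := @Ordinal 4 1 isT.
Definition tape2 : 'I_4 := @Ordinal 4 2 isT.
Definition tape3 : 'I_4 := @Ordinal 4 3 isT.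

Definition written (w : word) (t : tp) : Prop := ends_with (rev (map (bit W) w)) t.

Definition number (x : nat) : word := rcons (nseq x true) false.

Lemma unary_cons x s : unary (x :: s) = number x ++ unary s.
Proof. by []. Qed.

Lemma written_put w ts b : written w (ts tape0) ->
  finishes (put W tape0 b) 1 ts (fun ts' =>
    written (rcons w b) (ts' tape0) /\ forall k, k != tape0 -> ts' k = ts k).
Proof.
by move=> /(ends_with_put b); apply: finishes_weaken => s [e f]; split=> //; rewrite /written map_rcons rev_rcons.
Qed.

Lemma written_ones w x t : ends_with (nseq x one ++ rev (map (bit W) w)) t ->
  written (w ++ nseq x true) t.
Proof. by rewrite /written map_cat rev_cat map_nseq rev_nseq. Qed.

(** The number of ones depends on the symbol read on tape 1; [M] conditional writes take the place
    of branching. *)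
Fixpoint print_ones (f : symbol -> nat) (M : nat) : program :=
  match M with
  | 0 => Act (@idle W 3)
  | M'.+1 => Seq (print_ones f M') (Act (fun s k =>
      if (k == tape0) && (M' < f (s tape1)) then (one, MRight) else (s k, MStay)))
  end.

Lemma finishes_print_ones f M w ts : written w (ts tape0) ->
  finishes (print_ones f M) M.+1 ts (fun ts' =>
    written (w ++ nseq (minn M (f (under (ts tape1)))) true) (ts' tape0) /\
    forall k, k != tape0 -> ts' k = ts k).
Proof.
move=> wt; elim: M => [|M IH].
  by apply: finishes_act; rewrite write_idle min0n cats0.
apply: (finishes_le (t := M.+1 + 1)); first by rewrite addn1.
apply: finishes_seq IH _ => ts1 [w1 f1].
apply: finishes_act; split=> [|k k0]; last first.
  by rewrite /write (negPf k0) /= /heads f1 //; case: (ts k).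
rewrite /write eqxx /= /heads (f1 tape1) //.
have [Mf|Mf] := ltnP M (f (under (ts tape1))).
  rewrite (minn_idPl (ltnW Mf)) in w1; rewrite (minn_idPl Mf) -addn1.
  rewrite nseqD catA; apply: written_ones.
  by case: w1 => r br ->; exists (behead r) => //; apply: blank_behead.
move: w1; rewrite !(minn_idPr _) // ?(leqW Mf) //.
by case: (ts1 tape0).
Qed.

Definition print_const (f : symbol -> nat) (M : nat) : program :=
  Seq (print_ones f M) (put W tape0 false).

Lemma finishes_print_const f M w ts : written w (ts tape0) ->
  f (under (ts tape1)) <= M ->
  finishes (print_const f M) (M.+1 + 1) ts (fun ts' =>
    written (w ++ number (f (under (ts tape1)))) (ts' tape0) /\
    forall k, k != tape0 -> ts' k = ts k).
Proof.
move=> wt fM; apply: finishes_seq (finishes_print_ones f M wt) _ => ts1 [w1 f1].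
rewrite (minn_idPr fM) in w1.
apply: finishes_weaken (written_put false w1) => ts2 [w2 f2].
split=> [|k k0]; last by rewrite f2 // f1.
by rewrite /number -rcons_cat.
Qed.

Definition print_counter (i : 'I_4) : program :=
  Seq (transfer W i tape0) (put W tape0 false).

Lemma finishes_print_counter i x w ts : i != tape0 -> counter x (ts i) ->
  written w (ts tape0) ->
  finishes (print_counter i) (transfer_time x + 1) ts (fun ts' =>
    [/\ written (w ++ number x) (ts' tape0), counter x (ts' i)
      & forall k, k != tape0 -> k != i -> ts' k = ts k]).
Proof.
move=> i0 ci wt; apply: finishes_seq (finishes_transfer i0 ci wt) _ => ts1 [c1 w1 f1].
apply: finishes_weaken (written_put false (written_ones w1)) => ts2 [w2 f2].
split=> [||k k0 ki]; last by rewrite f2 // f1.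
  by rewrite /number -rcons_cat.
by rewrite f2.
Qed.

(** When tape 3 starts at [v], decrementing before printing makes the smaller endpoint run from
    [v.-1] down to 0. *)
Definition print_edge : program :=
  Seq (erase W tape3) (Seq (print_const (fun=> edge_code) edge_code)
    (Seq (print_counter tape3) (Seq (print_counter tape2) (step_left W tape3)))).

Definition print_edge_time (v : nat) : nat :=
  1 + ((edge_code.+1 + 1) + ((transfer_time v + 1) + ((transfer_time v + 1) + 1))).

Lemma transfer_time_le x y : x <= y -> transfer_time x <= transfer_time y.
Proof. rewrite /transfer_time; lia. Qed.

Lemma finishes_print_edge u v w ts : u < v ->
  counter_last u.+1 (ts tape3) -> counter v (ts tape2) -> written w (ts tape0) ->
  finishes print_edge (print_edge_time v) ts (fun ts' =>
    [/\ counter_last u (ts' tape3), counter v (ts' tape2),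
        written (w ++ unary [:: edge_code; u; v]) (ts' tape0) & ts' tape1 = ts tape1]).
Proof.
move=> uv c3 c2 w0.
apply: finishes_seq (counter_last_erase c3) _ => ts1 [c31 f1].
apply: (finishes_seq (finishes_print_const (f := fun=> edge_code) (w := w) _ (leqnn _))).
  by rewrite f1.
move=> ts2 [w2 f2].
apply: (finishes_seq (finishes_le _ (finishes_print_counter (i := tape3) (x := u) _ _ w2))) => //.
- by rewrite leq_add2r transfer_time_le // ltnW.
- by rewrite f2.
move=> ts3 [w3 c33 f3].
apply: (finishes_seq (finishes_print_counter (i := tape2) (x := v) _ _ w3)) => //.
  by rewrite f3 // f2 // f1.
move=> ts4 [w4 c24 f4].
have c34 : counter u (ts4 tape3) by rewrite f4.
apply: finishes_weaken (counter_step_left c34) => ts5 [c35 f5].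
split=> //; first by rewrite f5.
  by rewrite f5 //; move: w4; rewrite /unary /= cats0 !catA.
by rewrite f5 // f4 // f3 // f2 // f1.
Qed.

Definition print_edges : program :=
  Seq (step_left W tape3) (While (nonblank tape3) print_edge).

Definition print_edges_time (v : nat) : nat := 1 + (v * (print_edge_time v).+1).+1.

Definition edges_code (v : nat) : seq nat :=
  flatten [seq [:: edge_code; u; v] | u <- rev (iota 0 v)].

Lemma unary_cat s s' : unary (s ++ s') = unary s ++ unary s'.
Proof. by rewrite /unary map_cat flatten_cat. Qed.

Lemma finishes_print_edges v w ts :
  counter v (ts tape3) -> counter v (ts tape2) -> written w (ts tape0) ->
  finishes print_edges (print_edges_time v) ts (fun ts' =>
    [/\ counter 0 (ts' tape3), counter v (ts' tape2),
        written (w ++ unary (edges_code v)) (ts' tape0) & ts' tape1 = ts tape1]).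
Proof.
move=> c3 c2 w0; apply: finishes_seq (counter_step_left c3) _ => ts1 [c31 f1].
(* The edges already printed when tape 3 holds [u]. *)
pose part u := flatten [seq [:: edge_code; u; v] | u <- rev (iota u (v - u))].
pose Inv u (s : tapes_state) :=
  [/\ u <= v, counter_last u (s tape3), counter v (s tape2),
      written (w ++ unary (part u)) (s tape0) & s tape1 = ts tape1].
apply: (finishes_weaken (P := Inv 0)).
  move=> s [_ c30 c20 w00 e1]; split=> //; first exact: counter_last0.
  by rewrite /part subn0 in w00.
apply: (finishes_while (Inv := Inv)).
- move=> u s [uv c3u c2u w0u e1]; split; first by rewrite (counter_last_head c3u).
  apply: finishes_weaken (finishes_print_edge uv c3u c2u w0u) => s' [c3' c2' w0' e'].
  split=> //; [exact: ltnW| |by rewrite e'].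
  move: w0'; rewrite -catA -unary_cat; congr (written (_ ++ unary _) _).
  by rewrite /part -(subnSK uv) /= rev_cons map_rcons flatten_rcons.
- by move=> s [_ c30 _ _ _]; rewrite (counter_last_head c30).
- split=> //; [by rewrite f1| |by rewrite f1].
  by rewrite /part subnn cats0 f1.
Qed.

Definition symbol_code (s : symbol) : nat := if s is Some (inr i) then block_code i else 0.

Definition print_variable : program :=
  Seq (erase W tape2) (Seq (print_const symbol_code code_bound)
    (Seq (print_counter tape2) (Seq (transfer W tape2 tape3)
      (Seq print_edges (Seq (step_left W tape1) (step_left W tape2)))))).

Definition print_variable_time (v : nat) : nat :=
  1 + ((code_bound.+1 + 1) + ((transfer_time v + 1) + (transfer_time v +
    (print_edges_time v + (1 + 1))))).

Variables (i0 : 'I_n) (blocks : seq 'I_n).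

Definition variable_code (v : nat) : seq nat :=
  [:: block_code (nth i0 blocks v); v] ++ edges_code v.

Definition block_tape (v : nat) (t : tp) : Prop :=
  exists r, t = tape_before (rev (map (fun i => Some (inr i)) (take v blocks))) r.

Lemma block_tape_under v t : v < size blocks -> block_tape v.+1 t ->
  under t = Some (inr (nth i0 blocks v)).
Proof.
move=> vn [r ->]; rewrite (take_nth i0) // map_rcons rev_rcons.
by [].
Qed.

Lemma block_tape_step_left v ts : v < size blocks -> block_tape v.+1 (ts tape1) ->
  finishes (step_left W tape1) 1 ts (fun ts' =>
    block_tape v (ts' tape1) /\ forall k, k != tape1 -> ts' k = ts k).
Proof.
move=> vn [r E]; apply: finishes_act; split=> [|k k1]; last exact: write_off_tape.
rewrite write_on_tape E (take_nth i0) // map_rcons rev_rcons /=.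
by eexists; reflexivity.
Qed.

Lemma finishes_print_variable v w ts : v < size blocks ->
  counter_last v.+1 (ts tape2) -> counter 0 (ts tape3) -> block_tape v.+1 (ts tape1) ->
  written w (ts tape0) ->
  finishes print_variable (print_variable_time v) ts (fun ts' =>
    [/\ counter_last v (ts' tape2), counter 0 (ts' tape3), block_tape v (ts' tape1)
      & written (w ++ unary (variable_code v)) (ts' tape0)]).
Proof.
move=> vn c2 c3 b1 w0.
apply: finishes_seq (counter_last_erase c2) _ => ts1 [c21 f1].
have u1 : symbol_code (under (ts1 tape1)) = block_code (nth i0 blocks v).
  by rewrite f1 // (block_tape_under vn b1).
apply: (finishes_seq (finishes_print_const (f := symbol_code) (w := w) _ _)).
- by rewrite f1.
- by rewrite u1.
move=> ts2 [w2 f2]; rewrite u1 in w2.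
apply: (finishes_seq (finishes_print_counter (i := tape2) (x := v) _ _ w2)) => //.
  by rewrite f2.
move=> ts3 [w3 c23 f3].
have [z bz e3] : counter 0 (ts3 tape3) by rewrite f3 // f2 // f1.
apply: (finishes_seq (finishes_transfer (i := tape2) (j := tape3) _ c23 e3)) => //.
move=> ts4 [c24 e4 f4].
have c34 : counter v (ts4 tape3) by exists z.
have w4 : written ((w ++ number (block_code (nth i0 blocks v))) ++ number v) (ts4 tape0).
  by rewrite f4.
apply: (finishes_seq (finishes_print_edges c34 c24 w4)).
move=> ts5 [c35 c25 w5 e5].
have b5 : block_tape v.+1 (ts5 tape1) by rewrite e5 f4 // f3 // f2 // f1.
apply: (finishes_seq (block_tape_step_left vn b5)) => ts6 [b6 f6].
have c26 : counter v (ts6 tape2) by rewrite f6.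
apply: finishes_weaken (counter_step_left c26) => ts7 [c27 f7].
split; [exact: c27|by rewrite f7 // f6|by rewrite f7|].
rewrite f7 // f6 //; move: w5; congr (written _ _).
by rewrite /variable_code unary_cat /unary /= cats0 !catA.
Qed.

(* Tape 1 lists the block of each variable and tape 2 counts variables down; tape
   3 counts down the smaller endpoint of the edges. *)
Definition print_variables : program :=
  Seq (step_left W tape1) (Seq (step_left W tape2) (While (nonblank tape2) print_variable)).

Definition print_variables_time (N : nat) : nat :=
  1 + (1 + (N * (print_variable_time N).+1).+1).

Definition variables_code : seq nat :=
  flatten [seq variable_code v | v <- rev (iota 0 (size blocks))].

Lemma print_variable_time_le v N : v <= N -> print_variable_time v <= print_variable_time N.
Proof.
move=> vN; rewrite /print_variable_time /print_edges_time /print_edge_time.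
have := transfer_time_le vN; set a := transfer_time v; set b := transfer_time N => ab.
have : v * (1 + (edge_code.+1 + 1 + (a + 1 + (a + 1 + 1)))).+1 <=
       N * (1 + (edge_code.+1 + 1 + (b + 1 + (b + 1 + 1)))).+1.
  by apply: leq_mul => //; lia.
by set x := v * _; set y := N * _; lia.
Qed.

Lemma finishes_print_variables w ts :
  counter (size blocks) (ts tape2) -> counter 0 (ts tape3) ->
  ends_with (rev (map (fun i => Some (inr i)) blocks)) (ts tape1) -> written w (ts tape0) ->
  finishes print_variables (print_variables_time (size blocks)) ts (fun ts' =>
    written (w ++ unary variables_code) (ts' tape0)).
Proof.
move=> c2 c3 [r br e1] w0; set N := size blocks in c2 *.
apply: (finishes_seq (P := fun s => block_tape N (s tape1) /\ forall k, k != tape1 -> s k = ts k)).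
  apply: finishes_act; split=> [|k k1]; last exact: write_off_tape.
  rewrite write_on_tape e1 /block_tape take_size.
  by eexists; reflexivity.
move=> ts1 [b1 f1].
have c21 : counter N (ts1 tape2) by rewrite f1.
apply: finishes_seq (counter_step_left c21) _ => ts2 [c22 f2].
pose part v := flatten [seq variable_code v | v <- rev (iota v (N - v))].
pose Inv v (s : tapes_state) :=
  [/\ v <= N, counter_last v (s tape2), counter 0 (s tape3), block_tape v (s tape1)
    & written (w ++ unary (part v)) (s tape0)].
apply: (finishes_weaken (P := Inv 0)).
  by move=> s [_ _ _ _]; rewrite /part subn0.
apply: (finishes_while (Inv := Inv)).
- move=> v s [vN c2v c3v b1v w0v]; split; first by rewrite (counter_last_head c2v).
  apply: finishes_le (print_variable_time_le (ltnW vN)) _.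
  apply: finishes_weaken (finishes_print_variable vN c2v c3v b1v w0v) => s' [c2' c3' b1' w0'].
  split=> //; first exact: ltnW.
  move: w0'; rewrite -catA -unary_cat; congr (written (_ ++ unary _) _).
  by rewrite /part -(subnSK vN) /= rev_cons map_rcons flatten_rcons.
- by move=> s [_ c20 _ _ _]; rewrite (counter_last_head c20).
- split=> //; [by rewrite f2 // f1|by rewrite f2|].
  by rewrite /part subnn cats0 f2 // f1.
Qed.

End Printer.

(** * The whole program: merging block sizes, printing, rewinding *)

Section Reduction.

Variables (n : nat) (block_code : 'I_n -> nat) (code_bound edge_code : nat).
Hypothesis block_code_le : forall i, block_code i <= code_bound.
Variable i0 : 'I_n.

Notation W := ('I_n : finType).
Notation symbol := (option (bool + W)).
Notation tp := (tape (bool + W)).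
Notation tapes_state := (tapes_state W 3).
Notation program := (program W 3).
Notation one := (bit W true).
Notation zero := (bit W false).

Definition block_symbol (i : 'I_n) : symbol := Some (inr i).

Definition copy_block (i : 'I_n) : program :=
  While (fun s => s tape0 == one) (Act (fun s k =>
    if k == tape0 then (s k, MRight) else
    if k == tape1 then (block_symbol i, MRight) else
    if k == tape2 then (one, MRight) else (s k, MStay))).

Lemma cat_nseq_cons (T : Type) k (x : T) s : nseq k x ++ x :: s = x :: nseq k x ++ s.
Proof. by elim: k => //= k ->. Qed.

Lemma ends_with_moved l (t : tp) a : ends_with l t -> ends_with (a :: l) (write_move t (a, MRight)).
Proof. by move=> [r br ->]; exists (behead r) => //; apply: blank_behead. Qed.

Lemma finishes_copy_block i k l r l1 l2 ts :
  ts tape0 = tape_at l (nseq k one ++ zero :: r) ->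
  ends_with l1 (ts tape1) -> ends_with l2 (ts tape2) ->
  finishes (copy_block i) (k * 2).+1 ts (fun ts' =>
    [/\ ts' tape0 = tape_at (nseq k one ++ l) (zero :: r),
        ends_with (nseq k (block_symbol i) ++ l1) (ts' tape1),
        ends_with (nseq k one ++ l2) (ts' tape2) & ts' tape3 = ts tape3]).
Proof.
move=> e0 e1 e2.
pose Inv y (s : tapes_state) :=
  [/\ y <= k, s tape0 = tape_at (nseq (k - y) one ++ l) (nseq y one ++ zero :: r),
      ends_with (nseq (k - y) (block_symbol i) ++ l1) (s tape1),
      ends_with (nseq (k - y) one ++ l2) (s tape2) & s tape3 = ts tape3].
apply: (finishes_weaken (P := Inv 0)).
  by move=> s [_]; rewrite subn0.
apply: (finishes_while (tb := 1) (Inv := Inv)).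
- move=> y s [yk E0 E1 E2 E3]; split; first by rewrite /heads E0.
  apply: finishes_act; rewrite /Inv -(subnSK yk) /=; split; first exact: ltnW.
  + by rewrite /write /heads E0.
  + exact: ends_with_moved.
  + exact: ends_with_moved.
  + by rewrite -E3 /write /heads /=; case: (s tape3).
- by move=> s [_ E0 _ _ _]; rewrite /heads E0.
- by rewrite /Inv subnn.
Qed.

(* The zeros that separate the block sizes become ones: the header then reads as
   the number of variables, in unary, after [n.-1] superfluous ones, which [rewind]
   skips. *)
Fixpoint header (js : seq 'I_n) : program :=
  match js with
  | [::] => Act (@idle W 3)
  | i :: js' => Seq (copy_block i)
      (if js' is [::] then put W tape0 false else Seq (put W tape0 true) (header js'))
  end.

Lemma rev_number x : rev (map (bit W) (number x)) = zero :: nseq x one.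
Proof. by rewrite /number map_rcons rev_rcons map_nseq rev_nseq. Qed.

Definition block_list (js : seq 'I_n) (ks : seq nat) : seq 'I_n :=
  flatten [seq nseq p.2 p.1 | p <- zip js ks].

Lemma finishes_header js : forall ks l r l1 l2 ts, size ks = size js -> 0 < size js ->
  ts tape0 = tape_at l (map (bit W) (unary ks) ++ r) ->
  ends_with l1 (ts tape1) -> ends_with l2 (ts tape2) ->
  finishes (header js) (sumn ks * 2 + size ks * 2) ts (fun ts' =>
    [/\ ts' tape0 = tape_at (rev (map (bit W) (number (sumn ks + (size ks).-1))) ++ l) r,
        ends_with (rev (map block_symbol (block_list js ks)) ++ l1) (ts' tape1),
        ends_with (nseq (sumn ks) one ++ l2) (ts' tape2) & ts' tape3 = ts tape3]).
Proof.
elim: js => // i js IH [|k ks] // l r l1 l2 ts [sk] _ e0 e1 e2.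
have e0' : ts tape0 = tape_at l (nseq k one ++ zero :: (map (bit W) (unary ks) ++ r)).
  rewrite e0 unary_cons /number map_cat map_rcons map_nseq -catA cat_rcons.
  by [].
have [t et] : exists t, sumn (k :: ks) * 2 + size (k :: ks) * 2 = (k * 2).+1 + (1 + t).
  by exists (sumn ks * 2 + size ks * 2); rewrite /=; lia.
rewrite et; apply: finishes_seq (finishes_copy_block i e0' e1 e2) _.
move=> ts1 [E0 E1 E2 E3].
case: js => [|i' js] in IH sk *.
  case: ks => // in sk e0 e0' et E0 *.
  apply: (finishes_le (t := 1)); first by lia.
  apply: finishes_act; rewrite write_on_tape !write_off_tape // E0; split=> //.
  - by rewrite /= !addn0 rev_number.
  - by rewrite /block_list /= cats0 map_nseq rev_nseq.
  - by rewrite /= addn0.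
apply: finishes_seq.
  apply: (finishes_act (P := fun s => [/\ s tape0 = tape_at (one :: nseq k one ++ l) (map (bit W) (unary ks) ++ r),
    s tape1 = ts1 tape1, s tape2 = ts1 tape2 & s tape3 = ts1 tape3])).
  by rewrite write_on_tape !write_off_tape // E0.
move=> ts2 [F0 F1 F2 F3].
have -> : t = sumn ks * 2 + size ks * 2 by move: et; rewrite /=; lia.
apply: finishes_weaken (IH _ _ _ _ _ _ sk isT F0 _ _); last 2 first.
- by rewrite F1; exact: E1.
- by rewrite F2; exact: E2.
move=> s [G0 G1 G2 G3]; split.
- rewrite G0; congr tape_at; rewrite !rev_number /=; congr cons.
  have -> : k + sumn ks + size ks = (sumn ks + (size ks).-1) + (1 + k).
    by rewrite sk /=; lia.
  by rewrite (nseqD _ (1 + k)) -catA.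
- move: G1; congr (ends_with _ _).
  by rewrite /block_list /= !map_cat !rev_cat map_nseq rev_nseq -catA.
- move: G2; congr (ends_with _ _).
  by rewrite /= addnC nseqD -catA.
- by rewrite G3 F3 E3.
Qed.

Definition go_end : program := While (nonblank tape0) (step_right W tape0).

Lemma finishes_go_end w l ts : ts tape0 = tape_at l (map (bit W) w) ->
  finishes go_end (size w * 2).+1 ts (fun ts' =>
    ends_with (rev (map (bit W) w) ++ l) (ts' tape0) /\
    forall k, k != tape0 -> ts' k = ts k).
Proof.
move=> e0.
pose Inv y (s : tapes_state) :=
  (exists u v, [/\ w = u ++ v, size v = y &
     s tape0 = tape_at (rev (map (bit W) u) ++ l) (map (bit W) v)]) /\
  forall k, k != tape0 -> s k = ts k.
apply: (finishes_weaken (P := Inv 0)).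
  move=> s [[u [v [-> /size0nil -> E]]] f]; split=> //.
  by rewrite cats0 E; exists [::].
apply: (finishes_while (tb := 1) (Inv := Inv)).
- move=> y s [[u [v [Ew sv E]]] f].
  case: v => // b v in Ew sv E *; case: sv => sv.
  split; first by rewrite /nonblank /heads E.
  apply: finishes_act; split; last by move=> k k0; rewrite write_off_tape // f.
  exists (rcons u b), v; split=> //; first by rewrite cat_rcons.
  by rewrite write_on_tape E map_rcons rev_rcons.
- by move=> s [[u [v [_ /size0nil -> E]]] _]; rewrite /nonblank /heads E.
- by split=> //; exists [::], w.
Qed.

Fixpoint skip (m : nat) : program :=
  if m is m'.+1 then Seq (step_right W tape0) (skip m') else Act (@idle W 3).

Lemma finishes_skip m : forall l w r ts, blank r -> m <= size w ->
  ts tape0 = tape_at l (map (bit W) w ++ r) ->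
  finishes (skip m) m.+1 ts (fun ts' =>
    leading_bits (under (ts' tape0) :: after (ts' tape0)) = drop m w).
Proof.
elim: m => [|m IH] l w r ts br mw e0.
  by apply: finishes_act; rewrite write_idle e0 leading_bits_at leading_bits_blank // drop0.
apply: (finishes_le (t := 1 + m.+1)); first by [].
case: w => // b w in mw e0 *.
apply: finishes_seq.
  apply: (finishes_act (P := fun s => s tape0 = tape_at (bit W b :: l) (map (bit W) w ++ r))).
  by rewrite write_on_tape e0.
by move=> ts1 E1; apply: IH E1.
Qed.

Definition rewind (m : nat) : program :=
  Seq (step_left W tape0) (Seq (While (nonblank tape0) (step_left W tape0))
    (Seq (step_right W tape0) (skip m))).

(** Output is read from the head onwards, so stopping [m] cells into the word discards its first [m]
    letters. *)
Lemma finishes_rewind m w ts : written w (ts tape0) -> m <= size w ->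
  finishes (rewind m) (1 + ((size w * 2).+1 + (1 + m.+1))) ts (fun ts' =>
    leading_bits (under (ts' tape0) :: after (ts' tape0)) = drop m w).
Proof.
move=> [r br e0] mw.
pose Inv y (s : tapes_state) := exists u v r', [/\ w = u ++ v, size u = y, blank r' &
  s tape0 = tape_before (rev (map (bit W) u)) (map (bit W) v ++ r')].
apply: (finishes_seq (P := Inv (size w))).
  apply: finishes_act; exists w, [::], (None :: behead r); split=> //.
  - by rewrite cats0.
  - by rewrite /= blank_behead.
  - by rewrite write_on_tape e0 /= (blank_head br).
move=> ts1 I1; apply: (finishes_seq (P := Inv 0)).
  apply: (finishes_while (tb := 1) (Inv := Inv)) I1.
    move=> y s [u [v [r' [Ew su br' E]]]].
    case/lastP: u => [//|u b] in Ew su E *.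
    rewrite size_rcons in su; case: su => su.
    rewrite map_rcons rev_rcons in E.
    split; first by rewrite /nonblank /heads E.
    apply: finishes_act; exists u, (b :: v), r'; split=> //; first by rewrite -cat_rcons.
    by rewrite write_on_tape E.
  move=> s [u [v [r' [_ /size0nil -> _ E]]]].
  by rewrite /nonblank /heads E.
move=> ts2 [u [v [r' [Ew /size0nil Eu br' E]]]]; subst u.
rewrite /= in Ew; subst v.
apply: finishes_seq.
  apply: (finishes_act (P := fun s => s tape0 = tape_at [:: None] (map (bit W) w ++ r'))).
  by rewrite write_on_tape E.
by move=> ts3 E3; apply: finishes_skip br' mw E3.
Qed.

Definition reduction : program :=
  Seq (header (enum 'I_n)) (Seq go_end
    (Seq (print_variables block_code code_bound edge_code) (rewind n.-1))).

Notation extra_code bl := (variables_code block_code edge_code i0 bl).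

Definition reduction_time (ks atoms : seq nat) (bl : seq 'I_n) : nat :=
  (sumn ks * 2 + size ks * 2) + ((size (unary atoms) * 2).+1 +
    (print_variables_time code_bound edge_code (sumn ks) +
     (1 + ((size (number (sumn ks + (size ks).-1) ++ unary atoms ++ unary (extra_code bl)) * 2).+1
        + (1 + (n.-1).+1))))).

Lemma size_block_list js ks : size ks = size js -> size (block_list js ks) = sumn ks.
Proof.
elim: js ks => [|i js IH] [|k ks] //= [sk].
by rewrite /block_list /= size_cat size_nseq -/(block_list js ks) IH.
Qed.

Lemma finishes_reduction ks atoms : size ks = n ->
  finishes reduction (reduction_time ks atoms (block_list (enum 'I_n) ks))
    (@input_state W 3 (unary (ks ++ atoms))) (fun ts' =>
      leading_bits (under (ts' ord0) :: after (ts' ord0)) =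
      unary (sumn ks :: atoms ++ extra_code (block_list (enum 'I_n) ks))).
Proof.
move=> sk; have n0 : 0 < n by case: (n) i0 => // -[].
have sk' : size ks = size (enum 'I_n) by rewrite size_enum_ord.
set bl := block_list _ _; have sbl : size bl = sumn ks by exact: size_block_list.
set ts := @input_state W 3 _.
have e0 : ts tape0 = tape_at [::] (map (bit W) (unary ks) ++ map (bit W) (unary atoms)).
  by rewrite -map_cat -unary_cat.
have en k : k != tape0 -> ends_with [::] (ts k).
  move=> k0; exists [::] => //; rewrite /ts /input_state ifF //.
  by apply: contraNF k0 => /eqP ->; apply/eqP/val_inj.
apply: (finishes_seq (finishes_header sk' _ e0 (en tape1 isT) (en tape2 isT))).
  by rewrite size_enum_ord.
move=> ts1 [E0 E1 E2 E3].
apply: (finishes_seq (finishes_go_end E0)) => ts2 [F0 f2].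
have F0' : written (number (sumn ks + (size ks).-1) ++ unary atoms) (ts2 tape0).
  by rewrite /written map_cat rev_cat -[X in ends_with X _]cats0 -catA.
have [z bz c3] : counter 0 (ts2 tape3).
  by exists [::] => //; rewrite f2 // E3; apply: en.
have c2 : counter (size bl) (ts2 tape2).
  by rewrite sbl f2 //; exists [::].
have c1 : ends_with (rev (map block_symbol bl)) (ts2 tape1).
  by rewrite f2 //; rewrite cats0 in E1.
have pv := finishes_print_variables edge_code block_code_le i0 c2 (ex_intro2 _ _ z bz c3) c1 F0'.
rewrite sbl in pv.
apply: (finishes_seq pv) => ts3; rewrite -catA => w3.
apply: finishes_weaken (finishes_rewind w3 _); last first.
  by rewrite !size_cat size_rcons size_nseq sk; lia.
move=> s ->; rewrite unary_cons unary_cat.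
(* The [n.-1] ones left by the separators are exactly those skipped by [rewind]. *)
have -> : sumn ks + (size ks).-1 = n.-1 + sumn ks by rewrite sk addnC.
by rewrite /number nseqD rcons_cat -catA drop_size_cat // size_nseq.
Qed.

End Reduction.

(** For [L = 1] the additive constant suffices. For larger [L], the bound [L.+1 <= 2 * L] costs a
    factor 8, and [8 * a] is below [L ^ (8 * a)]. *)
Lemma poly_bound (a L t : nat) : 0 < L -> t <= a * L.+1 ^ 3 ->
  t <= L ^ (8 * a + 3) + (8 * a + 3).
Proof.
case: L => // -[|L] _ ht.
  by apply: leq_trans ht _; rewrite exp1n; lia.
apply: leq_trans (leq_addr _ _); apply: leq_trans ht _.
apply: (leq_trans (n := 8 * a * L.+2 ^ 3)).
  have -> : 8 * a * L.+2 ^ 3 = a * (2 * L.+2) ^ 3 by rewrite expnMn; lia.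
  by rewrite leq_mul2l leq_exp2r // orbC; lia.
rewrite expnD leq_mul2r; apply/orP; right.
by apply: ltnW; apply: ltn_expl.
Qed.

Lemma size_unary s : size (unary s) = sumn s + size s.
Proof.
elim: s => //= x s IH; rewrite unary_cons size_cat IH size_rcons size_nseq; lia.
Qed.

(** * Cubic bounds on output size and running time *)

Section TimeBound.

Variables (n : nat) (block_code : 'I_n -> nat) (M E : nat) (i0 : 'I_n).
Hypothesis block_code_le : forall i, block_code i <= M.

Lemma size_unary_flatten (T : eqType) (f : T -> seq nat) (s : seq T) b :
  (forall x, x \in s -> size (unary (f x)) <= b) ->
  size (unary (flatten [seq f x | x <- s])) <= size s * b.
Proof.
elim: s => //= x s IH fb; rewrite unary_cat size_cat mulSn.
apply: leq_add; first by apply: fb; rewrite mem_head.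
by apply: IH => y ys; apply: fb; rewrite in_cons ys orbT.
Qed.

Lemma size_edges_code v X : v < X -> size (unary (edges_code E v)) <= (E + 3) * X ^ 2.
Proof.
move=> vX; apply: leq_trans (_ : v * ((E + 3) * X) <= _).
  have := @size_unary_flatten _ (fun u => [:: E; u; v]) (rev (iota 0 v)) ((E + 3) * X).
  rewrite size_rev size_iota; apply=> u.
  rewrite mem_rev mem_iota => /andP[_ uv]; rewrite size_unary /=; nia.
by rewrite mulnC -mulnA leq_mul2l expnS expn1 leq_mul2l ltnW ?orbT.
Qed.

(** Cubic, since fewer than [X] variables have fewer than [X] edges each, with endpoints below [X]
    in unary. *)
Lemma size_variables_code (bl : seq 'I_n) X : size bl < X ->
  size (unary (variables_code block_code E i0 bl)) <= (M + E + 6) * X ^ 3.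
Proof.
move=> bX; apply: leq_trans (_ : size bl * ((M + E + 6) * X ^ 2) <= _).
  have := @size_unary_flatten _ (variable_code block_code E i0 bl)
    (rev (iota 0 (size bl))) ((M + E + 6) * X ^ 2).
  rewrite size_rev size_iota; apply=> v.
  rewrite mem_rev mem_iota => /andP[_ vb].
  have vX : v < X by apply: leq_trans vb (ltnW bX).
  rewrite /variable_code unary_cat size_cat size_unary.
  have := size_edges_code vX; have := block_code_le (nth i0 bl v).
  have XY : X <= X ^ 2 by rewrite expnS expn1 leq_pmulr //; lia.
  rewrite /=; move: (size (unary _)) (block_code _) (X ^ 2) XY => s b Y XY.
  have : M <= M * Y by rewrite leq_pmulr //; lia.
  nia.
have -> : X ^ 3 = X * X ^ 2 by rewrite expnS.
by rewrite mulnC -mulnA [X * _]mulnC leq_mul2l leq_mul2l ltnW ?orbT.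
Qed.

Lemma print_variables_time_le N X : N < X ->
  print_variables_time M E N <= (M + E + 35) * X ^ 3.
Proof.
move=> NX; rewrite /print_variables_time /print_variable_time /print_edges_time /print_edge_time.
have tX : transfer_time N <= 4 * X by rewrite /transfer_time; lia.
move: (transfer_time N) tX => t tX.
have h1 : N * (1 + (E.+1 + 1 + (t + 1 + (t + 1 + 1)))).+1 <= (E + 15) * X ^ 2.
  apply: leq_trans (_ : X * ((E + 15) * X) <= _).
    by apply: leq_mul; [exact: ltnW|nia].
  by rewrite expnS expn1; lia.
move: (N * _) h1 => a h1.
have h2 : N * (1 + (M.+1 + 1 + (t + 1 + (t + (1 + a.+1 + (1 + 1)))))).+1 <= (M + E + 32) * X ^ 3.
  apply: leq_trans (_ : X * ((M + E + 32) * X ^ 2) <= _); last by rewrite (expnS X 2); lia.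
  apply: leq_mul; first exact: ltnW.
  have XY : X <= X ^ 2 by rewrite expnS expn1 leq_pmulr //; lia.
  have : M <= M * X ^ 2 by rewrite leq_pmulr // expn_gt0; lia.
  by move: (X ^ 2) h1 XY => Y h1 XY MY; nia.
move: (N * _) h2 => b h2.
have X3 : 0 < X ^ 3 by rewrite expn_gt0; lia.
by move: (X ^ 3) X3 h2 => Y X3 h2; nia.
Qed.

Lemma reduction_time_le ks atoms : size ks = n ->
  reduction_time block_code M E i0 ks atoms (block_list (enum 'I_n) ks) <=
  (3 * M + 3 * E + 6 * n + 80) * (size (unary (ks ++ atoms))).+1 ^ 3.
Proof.
move=> sk; rewrite /reduction_time; set L := size (unary (ks ++ atoms)).
have EL : L = sumn ks + n + size (unary atoms).
  by rewrite /L unary_cat size_cat size_unary sk.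
have NX : sumn ks < L.+1 by lia.
have sbl : size (block_list (enum 'I_n) ks) < L.+1.
  by rewrite size_block_list // size_enum_ord.
have := size_variables_code sbl; have := print_variables_time_le NX.
rewrite !size_cat size_rcons size_nseq sk.
move: (print_variables_time _ _ _) (size (unary (variables_code _ _ _ _))) => a b.
have X3 : L.+1 <= L.+1 ^ 3 by rewrite expnS leq_pmulr // expn_gt0.
have : n <= n * L.+1 ^ 3 by rewrite leq_pmulr // expn_gt0.
by move: (L.+1 ^ 3) X3 => Y; nia.
Qed.

End TimeBound.

(** * Ranks in the enumerations of option and sum types *)

Section Ranks.

Lemma enum_rank_index (T : finType) (x : T) : enum_rank x = index x (enum T) :> nat.
Proof.
rewrite -{2}(nth_enum_rank x x) index_uniq ?enum_uniq // -cardE.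
exact: ltn_ord.
Qed.

Lemma enum_rank_None (T : finType) : enum_rank (None : option T) = 0 :> nat.
Proof. by rewrite enum_rank_index enumT unlock. Qed.

Lemma enum_rank_Some (T : finType) (x : T) : enum_rank (Some x) = (enum_rank x).+1 :> nat.
Proof.
rewrite !enum_rank_index {1}enumT unlock /= /option_enum /= index_map ?enumT //.
by move=> y z [].
Qed.

Lemma enum_rank_inl (T U : finType) (x : T) : enum_rank (inl x : T + U) = enum_rank x :> nat.
Proof.
rewrite !enum_rank_index {1}enumT unlock /= /sum_enum index_cat map_f ?mem_enum //.
by rewrite index_map ?enumT // => y z [].
Qed.

End Ranks.

(** * The printed word encodes the instance *)

Section Encoding.

Variables (tau : signature) (Q : seq quant) (i0 : 'I_(size Q)).

Notation n := (size Q).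
Notation sigma := (game_sig (atom_sig tau) n).
Notation qpp := (fun m => seq (atom tau m)).

Definition block_number (i : 'I_n) : nat := enum_rank (block_sym (atom_sig tau) i).
Definition edge_number : nat := enum_rank (distinct_sym (atom_sig tau) n).

Lemma block_number_le i : block_number i <= #|sigma|.
Proof. exact: ltnW (ltn_ord _). Qed.

(** This is what lets the machine leave the code of the matrix in place. It relies on [None] being
    enumerated first and on left summands preceding right ones. *)
Lemma atom_fact_code N (a : atom tau N) : fact_code (atom_fact Q a) = atom_code a.
Proof.
case: a => [|x y|R t]; rewrite /fact_code /atom_fact /=; congr cons.
- by rewrite enum_rank_inl enum_rank_None.
- by rewrite enum_rank_inl enum_rank_Some enum_rank_None.
- by rewrite enum_rank_inl !enum_rank_Some.
Qed.

Lemma qpp_codeE m Qs (phi : prenex qpp m Qs) :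
  qpp_code phi = block_sizes phi ++ flatten (map (@atom_code tau _) (matrix_atoms phi)).
Proof. by elim: phi => {m Qs} //= m q Qs k p ->. Qed.

Lemma flatten_map_flatten (X Y Z : Type) (f : Y -> seq Z) (g : X -> seq Y) s :
  flatten (map f (flatten (map g s))) = flatten [seq flatten (map f (g x)) | x <- s].
Proof. by elim: s => //= x s IH; rewrite map_cat flatten_cat IH. Qed.

Lemma extra_facts_code N (bl : seq 'I_n) : size bl = N ->
  flatten (map (@fact_code sigma N) (extra_facts tau N (nth i0 bl))) =
  variables_code block_number edge_number i0 bl.
Proof.
move=> sN; rewrite /variables_code sN /extra_facts.
have -> : rev (iota 0 N) = map val (rev (enum 'I_N)) by rewrite map_rev val_enum_ord.
rewrite flatten_map_flatten -map_comp; congr flatten; apply: eq_map => v.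
rewrite /= /variable_code /edges_code -map_comp; congr (_ :: _ :: flatten _).
have -> : rev (iota 0 v) = map val [seq u : 'I_N <- rev (enum 'I_N) | u < v].
  rewrite filter_rev map_rev; congr rev.
  rewrite -(filter_map val (fun u => u < v)) val_enum_ord.
  exact/esym/(filter_iota_ltn 0 (ltnW (ltn_ord v))).
by rewrite -map_comp.
Qed.

Lemma map_val_block_list ks : size ks = n ->
  map val (block_list (enum 'I_n) ks) = block_indices 0 ks.
Proof.
have gen (s : seq 'I_n) i : forall ks, size ks = size s ->
    map val s = iota i (size s) -> map val (block_list s ks) = block_indices i ks.
  elim: s i => [|j s IH] i [|k ks'] //= [sk] [ji es].
  by rewrite /block_list /= map_cat map_nseq ji -/(block_list s ks') (IH i.+1).
by move=> sk; apply: gen; rewrite ?size_enum_ord // val_enum_ord.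
Qed.

Lemma blocks_agree_indices (blk : nat -> 'I_n) m Qs (phi : prenex qpp m Qs) : forall i,
  (forall v, v < sumn (block_sizes phi) ->
     blk (m + v) = nth 0 (block_indices i (block_sizes phi)) v :> nat) ->
  blocks_agree blk i phi.
Proof.
elim: phi => {m Qs} //= m q Qs k p IH i h; split.
  move=> v /andP[mv vk]; rewrite -(subnKC mv) h; last by lia.
  by rewrite nth_cat size_nseq ifT ?nth_nseq ?ifT //; lia.
apply: IH => v vs; rewrite -addnA h; last by lia.
by rewrite nth_cat size_nseq ifF ?addKn //; lia.
Qed.

Definition blocks_of (ks : seq nat) : seq 'I_n := block_list (enum 'I_n) ks.

Lemma sentence_blocks_agree (phi : qpp_sentence tau Q) :
  blocks_agree (nth i0 (blocks_of (block_sizes phi))) 0 phi.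
Proof.
have sk := size_block_sizes phi.
apply: blocks_agree_indices => v vs; rewrite add0n -map_val_block_list //.
by rewrite (nth_map i0) // size_block_list // size_enum_ord.
Qed.

Definition instance_of (phi : qpp_sentence tau Q) : finite_structure sigma :=
  existT _ (num_vars phi) (instance_structure (nth i0 (blocks_of (block_sizes phi))) phi).

Lemma instance_of_encoding (phi : qpp_sentence tau Q) :
  encodes_structure (instance_of phi)
    (unary (sumn (block_sizes phi) ::
      flatten (map (@atom_code tau _) (matrix_atoms phi)) ++
      variables_code block_number edge_number i0 (blocks_of (block_sizes phi)))).
Proof.
eexists; split; first by move=> R t; exact: iff_refl.
congr unary; rewrite /= map_cat flatten_cat -map_comp.
congr (_ :: flatten _ ++ _); first by rewrite num_varsE.
   by apply: eq_map => a; rewrite /= atom_fact_code.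
rewrite extra_facts_code // size_block_list; last by rewrite size_enum_ord size_block_sizes.
by rewrite num_varsE.
Qed.

Variables (B : finType) (SB : structure tau B).

Theorem reduction_correct (b0 : B) :
  QCSP_reduces_to_CSP SB Q (limit (atom_structure SB) Q).
Proof.
exists (machine (reduction block_number #|sigma| edge_number)).
(* The factor of [reduction_time_le]; the exponent is then the one of [poly_bound]. *)
pose a := 3 * #|sigma| + 3 * edge_number + 6 * n + 80.
exists (8 * a + 3) => phi w ->.
exists (instance_of phi); eexists; split; [|exact: instance_of_encoding|].
- rewrite qpp_codeE; apply: machine_computes.
  have sk := size_block_sizes phi.
  apply: finishes_le (finishes_reduction edge_number block_number_le i0 _ sk).
  apply: poly_bound; last exact: (reduction_time_le edge_number i0 block_number_le _ sk).
  have n0 : 0 < n by case: (n) i0 => // -[].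
  by rewrite size_unary size_cat sk; lia.
- rewrite (limit_CSP _ b0) (instance_won SB b0 (sentence_blocks_agree phi)).
  exact: iff_refl.
Qed.

End Encoding.

(** * Templates with empty domain *)

Section EmptyScan.

Notation W := (bool : finType).
Notation symbol := (option (bool + W)).
Notation program := (program W 1).
Notation tapes_state := (tapes_state W 1).

Definition input_tape2 : 'I_2 := ord0.
Definition mark_tape : 'I_2 := @Ordinal 2 1 isT.

Definition is_all (q : quant) : bool := if q is QAll then true else false.

Definition first_quant (Qs : seq quant) (ks : seq nat) : option quant :=
  ohead [seq p.1 | p <- zip Qs ks & p.2 != 0].

(** The code of a block size starts with a one exactly when the block is nonempty; the first such
    block is recorded on the mark tape, after which scanning changes nothing. *)
Definition scan_block (q : quant) : program := Act (fun s k =>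
  if s mark_tape is None then
    if s input_tape2 == bit W true then
      if k == mark_tape then (Some (inr (is_all q)), MStay) else (s k, MStay)
    else if k == mark_tape then (s k, MStay) else (s k, MRight)
  else (s k, MStay)).

Fixpoint scan (Qs : seq quant) : program :=
  if Qs is q :: Qs' then Seq (scan_block q) (scan Qs') else Act (@idle W 1).

Lemma finishes_scan_marked Qs : forall ts, under (ts mark_tape) <> None ->
  finishes (scan Qs) (size Qs).+1 ts (fun ts' => ts' = ts).
Proof.
elim: Qs => [|q Qs IH] ts um; first by apply: finishes_act; rewrite write_idle.
apply: (finishes_le (t := 1 + (size Qs).+1)); first by [].
apply: (finishes_seq (P := fun s => s = ts)); last by move=> s ->; apply: IH.
apply: finishes_act; rewrite -[RHS]write_idle; congr write; apply/funext => k.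
by rewrite /heads; case: (under (ts mark_tape)) um.
Qed.

Definition scanned (Qs : seq quant) (ks : seq nat) (l r : seq symbol) (ts : tapes_state) : Prop :=
  if first_quant Qs ks is Some q then
    under (ts mark_tape) = Some (inr (is_all q)) /\
    exists l' r', ts input_tape2 = tape_at l' r'
  else under (ts mark_tape) = None /\
    ts input_tape2 = tape_at (nseq (size ks) (bit W false) ++ l) r.

Lemma finishes_scan Qs : forall ks l r ts, size ks = size Qs ->
  ts input_tape2 = tape_at l (map (bit W) (unary ks) ++ r) -> under (ts mark_tape) = None ->
  finishes (scan Qs) (size Qs).+1 ts (scanned Qs ks l r).
Proof.
elim: Qs => [|q Qs IH] [|k ks] //= l r ts.
  by move=> _ e0 e1; apply: finishes_act; rewrite write_idle.
move=> [sk] e0 e1; apply: (finishes_le (t := 1 + (size Qs).+1)); first by [].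
case: k => [|k] in e0 *.
  apply: (finishes_seq (P := fun s =>
    s input_tape2 = tape_at (bit W false :: l) (map (bit W) (unary ks) ++ r) /\
    under (s mark_tape) = None)).
    apply: finishes_act; rewrite /write /heads e1 e0 /=.
    by split=> //; case: (ts mark_tape).
  move=> ts1 [E0 E1]; apply: finishes_weaken (IH _ _ _ _ sk E0 E1) => s.
  rewrite /scanned /first_quant /=; case: ohead => // -[E ->]; split=> //.
  by rewrite cat_nseq_cons.
apply: (finishes_seq (P := fun s =>
  under (s mark_tape) = Some (inr (is_all q)) /\ exists l' r', s input_tape2 = tape_at l' r')).
  apply: finishes_act; rewrite /write /heads e1 e0 /=; split.
    by case: (ts mark_tape).
  by exists l, (map (bit W) (unary (k.+1 :: ks)) ++ r).
move=> ts1 [E1 E2]; apply: finishes_weaken (finishes_scan_marked _ _); last by rewrite E1.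
by move=> s ->.
Qed.

Definition on_mark (none exi all : symbol -> symbol * move) : program :=
  Act (fun s k => if k == input_tape2 then
    match s mark_tape with
    | Some (inr b) => if b then all (s k) else exi (s k)
    | _ => none (s k)
    end else (s k, MStay)).

Let stay (s : symbol) := (s, MStay).
Let left (s : symbol) := (s, MLeft).
Let zero_right (s : symbol) := (bit W false, MRight).
Let blank_left (s : symbol) := (None : symbol, MLeft).

(* Prints [0 0], a structure with empty domain in which the relation number 0
   holds, if the first quantifier is existential; prints [0], the empty structure,
   if it is universal; otherwise turns the last zero into the size of the domain
   and keeps the atoms. *)
Definition answer : program :=
  Seq (on_mark left zero_right zero_right)
    (Seq (on_mark stay zero_right blank_left)
      (Seq (on_mark stay blank_left stay) (on_mark stay left stay))).

Lemma on_mark_spec none exi all ts b :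
  under (ts mark_tape) = Some (inr b) ->
  finishes (on_mark none exi all) 1 ts (fun ts' =>
    ts' input_tape2 = write_move (ts input_tape2)
      ((if b then all else exi) (under (ts input_tape2))) /\
    under (ts' mark_tape) = Some (inr b)).
Proof.
move=> e1; apply: finishes_act; rewrite /write /heads e1 /=; split; first by case: b {e1}.
by rewrite -e1; case: (ts mark_tape).
Qed.

Lemma on_mark_spec_none none exi all ts :
  under (ts mark_tape) = None ->
  finishes (on_mark none exi all) 1 ts (fun ts' =>
    ts' input_tape2 = write_move (ts input_tape2) (none (under (ts input_tape2))) /\
    under (ts' mark_tape) = None).
Proof.
move=> e1; apply: finishes_act; rewrite /write /heads e1 /=; split=> //.
by case: (ts mark_tape).
Qed.

Lemma write_move_stay (t : tape (bool + W)) : write_move t (stay (under t)) = t.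
Proof. by case: t. Qed.

Lemma finishes_answer Qs ks atoms ts : size ks = size Qs -> 0 < size Qs ->
  scanned Qs ks [::] (map (bit W) (unary atoms)) ts ->
  finishes answer 4 ts (fun ts' =>
    leading_bits (under (ts' input_tape2) :: after (ts' input_tape2)) =
    match first_quant Qs ks with
    | Some QEx => unary [:: 0; 0]
    | Some QAll => unary [:: 0]
    | None => unary (0 :: atoms)
    end).
Proof.
move=> sk Q0; rewrite /scanned; case: first_quant => [q|].
  move=> [e1 [l [r e0]]].
  apply: (finishes_seq (on_mark_spec _ _ _ e1)) => ts1 [E1 m1].
  apply: (finishes_seq (on_mark_spec _ _ _ m1)) => ts2 [E2 m2].
  apply: (finishes_seq (on_mark_spec _ _ _ m2)) => ts3 [E3 m3].
  apply: finishes_weaken (on_mark_spec _ _ _ m3) => ts4 [-> _].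
  by rewrite E3 E2 E1 e0; case: q {e1 m1 m2 m3 E1 E2 E3}.
move=> [e1 e0].
apply: (finishes_seq (on_mark_spec_none _ _ _ e1)) => ts1 [E1 m1].
apply: (finishes_seq (on_mark_spec_none _ _ _ m1)) => ts2 [E2 m2].
apply: (finishes_seq (on_mark_spec_none _ _ _ m2)) => ts3 [E3 m3].
apply: finishes_weaken (on_mark_spec_none _ _ _ m3) => ts4 [-> _].
rewrite write_move_stay E3 write_move_stay E2 write_move_stay E1 e0.
rewrite -sk in Q0; case: (size ks) Q0 => // m _ /=.
rewrite unary_cons /=; congr cons.
have := @leading_bits_blank W (unary atoms) [::] isT; rewrite cats0.
by case: (map _ (unary atoms)).
Qed.


End EmptyScan.

(** * Correctness for empty templates *)

Section EmptyTemplate.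

Variables (tau : signature) (Q : seq quant) (i0 : 'I_(size Q)).
Variables (B : finType) (SB : structure tau B).
Arguments SB : clear implicits.
Hypothesis B0 : B -> False.

Notation n := (size Q).
Notation sigma := (game_sig (atom_sig tau) n).
Notation qpp := (fun m => seq (atom tau m)).

(** When [B] is empty only nullary relations can hold, and they keep their truth values here; the
    single point makes the game construction applicable. *)
Definition nullary_structure : structure tau unit := fun R _ => exists t, SB R t.

Notation sat_qpp SB := (sat_prenex (fun m e (s : seq (atom tau m)) =>
  forall i : 'I_(size s), sat_atom SB e (tnth (in_tuple s) i))).

(** Empty blocks bind nothing. The first nonempty block ranges over elements of [B]: it fails if
    existential and holds vacuously if universal. Without variables only falsity and nullary atoms
    remain. *)
Lemma first_quant_sat m Qs (phi : prenex qpp m Qs) (e : 'I_m -> B) :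
  match first_quant Qs (block_sizes phi) with
  | Some QEx => ~ sat_qpp SB e phi
  | Some QAll => sat_qpp SB e phi
  | None => forall e' : 'I_m -> unit, sat_qpp SB e phi <-> sat_qpp nullary_structure e' phi
  end.
Proof.
elim: phi e => {m Qs} [m s|m q Qs k p IH] e.
  move=> e'; have same (a : atom tau m) : sat_atom SB e a <-> sat_atom nullary_structure e' a.
    case: a => [|x y|R t] //=; first by case: (B0 (e x)).
    split=> [h|[t' h]]; first by exists (map_tuple e t).
    have -> // : map_tuple e t = t'.
    by apply: eq_from_tnth => j; case: (B0 (tnth t' j)).
  by split=> h i; apply/same.
rewrite /first_quant /=; case: k => [|k] in p IH *; last first.
  case: q => /=; first by case=> v; case: (B0 (v ord0)).
  by move=> v; case: (B0 (v ord0)).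
have uniq (T : Type) (f g : 'I_0 -> T) : f = g by apply/funext => -[].
have := IH (extend_block e (@no_vars B)); rewrite /first_quant /=.
case: ohead => [[]|] h; case: q => //=.
- by case=> v; rewrite (uniq _ v (@no_vars B)).
- exists (@no_vars B); exact: h.
- by move=> v; rewrite (uniq _ v (@no_vars B)).
- move=> e'; have := h (extend_block e' (@no_vars unit)).
  split=> [[v]|[v]]; rewrite (uniq _ v (@no_vars _)).
    by move=> /h; exists (@no_vars unit).
  by move=> /h; exists (@no_vars B).
- move=> e'; have := h (extend_block e' (@no_vars unit)).
  split=> hv v; rewrite (uniq _ v (@no_vars _)).
    by apply/h; apply: hv.
  by apply/h; apply: hv.
Qed.

Lemma first_quant_none Qs ks : size ks = size Qs -> first_quant Qs ks = None -> sumn ks = 0.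
Proof.
by elim: ks Qs => [|[|k] ks IH] [|q Qs] //= [/IH h]; rewrite /first_quant /= => /h.
Qed.

Definition false_instance : finite_structure sigma :=
  existT _ 0 (facts_structure [:: atom_fact Q (AFalse tau 0)]).

Definition true_instance : finite_structure sigma :=
  existT _ 0 (@facts_structure tau Q 0 [::]).

Lemma not_wins_false (U : finType) (SU : structure tau U) T (S : structure sigma T) Qs : forall i H,
  S (@constr (atom_sig tau) n None) [tuple] -> ~ wins (atom_structure SU) S Qs i H.
Proof.
elim: Qs => [|[] Qs IH] i H St /=.
- apply; exists None, [tuple], [tuple]; split=> // -[] //.
- by case=> w [_ /IH]; apply.
(* The empty move is legal, and a violated nullary constraint needs no labels. *)
- move=> h; apply: (IH _ _ St (h (fun _ => finset.set0) _)).
  by move=> x y b b'; rewrite finset.inE.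
Qed.

(* On an empty domain the first nonempty block decides the sentence; without
   variables only the nullary relations matter. *)
Theorem empty_reduction_correct :
  QCSP_reduces_to_CSP SB Q (limit (atom_structure nullary_structure) Q).
Proof.
(* Scanning takes [n.+1] steps and answering 4, so the additive constant alone bounds the time. *)
have n0 : 0 < n by case: (n) i0 => // -[].
exists (machine (Seq (scan Q) answer)), (n + 5) => phi w ->.
have sk := size_block_sizes phi.
have run : computes_within (machine (Seq (scan Q) answer)) (unary (qpp_code phi))
    (size (unary (qpp_code phi)) ^ (n + 5) + (n + 5))
    (match first_quant Q (block_sizes phi) with
    | Some QEx => unary [:: 0; 0]
    | Some QAll => unary [:: 0]
    | None => unary (0 :: flatten (map (@atom_code tau _) (matrix_atoms phi)))
    end).
  apply: machine_computes; apply: (finishes_le (t := n.+1 + 4)); first by lia.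
  pose r := map (bit (bool : finType)) (unary (flatten (map (@atom_code tau _) (matrix_atoms phi)))).
  apply: (finishes_seq (@finishes_scan Q _ [::] r _ sk _ _)) => //.
    by rewrite qpp_codeE unary_cat /r -map_cat.
  by move=> ts'; apply: finishes_answer.
have := first_quant_sat phi (@no_vars B).
case E : first_quant run => [[]|] run hs.
- exists false_instance; eexists; split; [exact: run| |].
    exists [:: atom_fact Q (AFalse tau 0)]; split; first by move=> R t; exact: iff_refl.
    congr (unary (_ :: _)).
    exact: (esym (congr1 (fun s => s ++ [::]) (atom_fact_code Q (AFalse tau 0)))).
  split=> // /(limit_CSP _ tt) h; case: (not_wins_false _ h).
  by rewrite /= /facts_structure mem_head.
- exists true_instance; eexists; split; [exact: run| |].
    by exists [::].
  split=> // _; exists (@no_vars nat) => R t.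
  by rewrite /= /facts_structure.
(* Without variables no markers or edges are appended, so the usual instance is coded by 0 followed
   by the atoms. *)
- exists (instance_of i0 phi); eexists; split; [exact: run| |].
    have := instance_of_encoding i0 phi.
    rewrite (first_quant_none sk E) /variables_code /blocks_of size_block_list.
      by rewrite (first_quant_none sk E) cats0.
    by rewrite size_enum_ord.
  rewrite (limit_CSP _ tt) (instance_won _ tt (sentence_blocks_agree _ phi)).
  exact: hs (@no_vars unit).
Qed.

End EmptyTemplate.

Local Open Scope classical_set_scope.

Theorem theorem1p2 (tau : signature) (B : finType) (SB : structure tau B)
    (n : nat) (Q : n.-tuple quant) (hn : 1 <= n)
    (hQ : exists i : 'I_n, tnth Q i = QAll) :
  exists (sigma : signature) (D : Type) (SD : structure sigma D),
    [/\ countable [set: D],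
        omega_categorical SD,
        exists Phi : mso_sentence sigma Q,
          forall (A : finType) (SA : structure sigma A),
            CSP SD SA <-> mso_holds SA Phi
      & QCSP_reduces_to_CSP SB Q SD].
Proof.
have i0 : 'I_(size Q) by rewrite size_tuple; exact: Ordinal hn.
have witness (C : finType) (c0 : C) (SC : structure tau C) :
    QCSP_reduces_to_CSP SB Q (limit (atom_structure SC) Q) ->
    exists (sigma : signature) (D : Type) (SD : structure sigma D),
    [/\ countable [set: D],
        omega_categorical SD,
        exists Phi : mso_sentence sigma Q,
          forall (A : finType) (SA : structure sigma A),
            CSP SD SA <-> mso_holds SA Phi
      & QCSP_reduces_to_CSP SB Q SD].
  move=> red; exists (game_sig (atom_sig tau) (size Q)), nat, (limit (atom_structure SC) Q).
  split=> //.
  - exact: (limit_omega_categorical _ c0).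
  - exists (game_sentence (atom_structure SC) Q) => A SA.
    by rewrite (limit_CSP _ c0) -game_sentence_won.
(* A nonempty template is used as it stands; an empty one is replaced by its one-point
   substitute. *)
have [[b0]|B0] := pselect (inhabited B).
  exact: witness b0 _ (reduction_correct i0 SB b0).
apply: (witness (unit : finType) tt _ (empty_reduction_correct i0 _ _)) => b.
by apply: B0; exists.
Qed.
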